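(* Let $T>0$ and let $H,L:[0,T]\to\mathbb{C}^{N\times N}$ be continuous Hermitian-matrix-valued functions with $L(t)\succeq 0$ for all $t$, and set $A(t)=L(t)+\mathrm{i}H(t)$. Let $\eta_{\max}=\int_0^T\alpha_{\max}(t)\,\mathrm{d}t$, where $\alpha_{\max}(t)$ is the largest eigenvalue of $L(t)$. Then for every $\epsilon_1\in(0,1)$ there exist real numbers $k'_1,\dots,k'_J$ and complex coefficients $c_1,\dots,c_J$ such that \[ \Big\|\mathcal{T}\mathrm{e}^{-\int_0^T A(s)\mathrm{d}s}-\sum_{j=1}^J c_jU_j\Big\|\le\epsilon_1,\qquad U_j=\mathcal{T}\mathrm{e}^{-\mathrm{i}\int_0^T(H(s)+k'_jL(s))\mathrm{d}s}, \] where $\|\cdot\|$ is the spectral norm, and moreover $J\in\mathcal{O}\big(\log\frac{1}{\epsilon_1}\,(\log\frac{1}{\epsilon_1}+\eta_{\max})\big)$, $\max_j|k'_j|\in\mathcal{O}(\log\frac{1}{\epsilon_1})$, and $\sum_j|c_j|\in\mathcal{O}(1)$, with the implied constants independent of $N$, $T$, $H$, $L$ and $\epsilon_1$.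
   Context: For a continuous matrix-valued function $B:[0,T]\to\mathbb{C}^{N\times N}$, the time-ordered exponential $\mathcal{T}\mathrm{e}^{-\int_0^T B(s)\,\mathrm{d}s}$ denotes $V(T)$, where $V$ solves $\frac{\mathrm{d}V}{\mathrm{d}t}=-B(t)V(t)$, $V(0)=I$. Each $U_j$ is unitary, being the evolution under the Hermitian Hamiltonian $H(s)+k'_jL(s)$. *)

(* Defs.v *)
From HB Require Import structures.
From mathcomp Require Import all_boot all_order all_algebra.
From mathcomp Require Import complex.
From mathcomp Require Import all_classical all_reals all_analysis.
Set Implicit Arguments. Unset Strict Implicit. Unset Printing Implicit Defensive.
Import Order.TTheory GRing.Theory Num.Theory.
Import numFieldTopology.Exports numFieldNormedType.Exports.
Local Open Scope ring_scope.
Local Open Scope classical_set_scope.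
Local Open Scope complex_scope.

Section Defs.
Variable R : realType.
Local Notation C := R[i].

Definition adjmx m n (M : 'M[C]_(m, n)) : 'M[C]_(n, m) := (map_mx conjc M)^T.

Definition is_hermitian n (M : 'M[C]_n) : Prop := adjmx M = M.

(* positive semidefinite: v^* M v >= 0 (real, nonnegative) for all v *)
Definition psd n (M : 'M[C]_n) : Prop :=
  forall v : 'cV[C]_n, 0 <= (adjmx v *m M *m v) 0 0.

Definition cabs2 (z : C) : R := complex.Re z ^+ 2 + complex.Im z ^+ 2.
Definition cabs (z : C) : R := Num.sqrt (cabs2 z).

Definition vnorm n (v : 'cV[C]_n) : R := Num.sqrt (\sum_i cabs2 (v i 0)).

Definition specnorm m n (M : 'M[C]_(m, n)) : R :=
  sup [set vnorm (M *m v) | v in [set v : 'cV[C]_n | vnorm v <= 1]].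

(* largest eigenvalue of a Hermitian matrix (its eigenvalues are real) *)
Definition lambda_max n (M : 'M[C]_n) : R :=
  sup [set x : R | eigenvalue M x%:C].

Definition mx_cont_on n (T : R) (B : R -> 'M[C]_n) : Prop :=
  forall i j, {within `[0, T], continuous (fun t : R => complex.Re (B t i j))} /\
              {within `[0, T], continuous (fun t : R => complex.Im (B t i j))}.

Definition toe_sol n (B : R -> 'M[C]_n) (T : R) (V : R -> 'M[C]_n) : Prop :=
  V 0 = 1%:M /\ mx_cont_on T V /\
  forall t, 0 < t < T -> forall i j,
    is_derive t 1 (fun s => complex.Re (V s i j)) (complex.Re ((- (B t *m V t)) i j)) /\
    is_derive t 1 (fun s => complex.Im (V s i j)) (complex.Im ((- (B t *m V t)) i j)).

(* time-ordered exponential  T exp(- int_0^T B(s) ds) := V(T) *)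
Definition texp n (B : R -> 'M[C]_n) (T : R) : 'M[C]_n :=
  xget 0 [set M | exists V, toe_sol B T V /\ V T = M].

End Defs.

(* Main.v *)
(** Write [U(k)] for the evolution generated by [i(H + kL)], so that the target is
    [U(-i)].  Fix a large integer [D], put [s = 1 - 1/D], let [z_0, ..., z_(q-1)]
    be the [q]-th roots of unity with [q = P D], and let [G(z)] be the evolution
    generated by [iH + D(1 - z)L].  Then [G(s) = U(-i)], while for
    [z = exp(i phi)] near [1] the operator [G(z)] is close to the unitary
    [U(-D sin phi)].

    Discrete Fourier inversion provides weights [c_i] with
    [sum_i c_i z_i^m = s^m] for [0 <= m <= (P-2)D].  The vectors
    [psi_m = sum_i c_i z_i^m G(z_i)v - s^m G(s)v] solve the upwind scheme
    [psi_m' = -iH psi_m - D L (psi_m - psi_(m+1))] and vanish at time [0] for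
    [m <= (P-2)D].  Information travels at finite speed, so an energy estimate with
    weights [2^-m] bounds [|psi_0(T)|^2] by a multiple of
    [exp(D eta) 2^(-(P-2)D)], which tends to [0] with [1/D] as soon as
    [P - 2 > eta / ln 2].  Hence [U(-i)] is approximated by [sum_i c_i G(z_i)].

    Filtering [s^m] by one moving average of length [D] and [n] moving averages of
    length [D/n] makes the weights decay like [P / (P^2 + b^2)], with an extra
    factor [2^-n] once [|b| >= 10 n P] ([b] being the centred index), while changing
    nothing for [m <= (P-2)D].  So the weights are summable uniformly in all
    parameters, and with [n] of order [ln (1/eps)] only [O(nP)] nodes matter; for
    these [D sin phi] is [O(n)], and [G(z)] may be replaced by [U(-D sin phi)]
    when [D] is large.  All [G(z)] with [|z| <= 1] are contractions because [L >= 0]. *)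

Require Import Defs.
From HB Require Import structures.
From mathcomp Require Import all_boot all_order all_algebra.
From mathcomp Require Import complex.
From mathcomp Require Import all_classical all_reals all_analysis.
From mathcomp Require Import ring lra zify.
Import Order.TTheory GRing.Theory Num.Theory.
Import numFieldTopology.Exports numFieldNormedType.Exports.
Local Open Scope ring_scope.
Local Open Scope classical_set_scope.
Local Open Scope complex_scope.

(** * Linear differential equations on a segment *)

Lemma within_continuous_sum (R : realType) (I : Type) (r : seq I) (A : set R)
    (f : I -> R -> R) :
  (forall i, {within A, continuous (f i)}) ->
  {within A, continuous (fun t => \sum_(i <- r) f i t)}.
Proof.
move=> cf; elim: r => [|i r IH].
  have -> : (fun t => \sum_(i <- [::]) f i t) = cst 0.
    by apply/funext => t; rewrite big_nil.
  by apply: continuous_subspaceT => x; exact: cvg_cst.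
have -> : (fun t => \sum_(j <- i :: r) f j t) = (f i \+ fun t => \sum_(j <- r) f j t).
  by apply/funext => t; rewrite big_cons.
by move=> x; apply: continuousD; [exact: cf|exact: IH].
Qed.

Lemma within_continuous_mul (R : realType) (A : set R) (f g : R -> R) :
  {within A, continuous f} -> {within A, continuous g} ->
  {within A, continuous (fun t => f t * g t)}.
Proof. by move=> cf cg x; apply: continuousM; [exact: cf|exact: cg]. Qed.

Lemma within_continuous_add (R : realType) (A : set R) (f g : R -> R) :
  {within A, continuous f} -> {within A, continuous g} ->
  {within A, continuous (fun t => f t + g t)}.
Proof. by move=> cf cg x; apply: continuousD; [exact: cf|exact: cg]. Qed.

Lemma within_continuous_sub (R : realType) (A : set R) (f g : R -> R) :
  {within A, continuous f} -> {within A, continuous g} ->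
  {within A, continuous (fun t => f t - g t)}.
Proof. by move=> cf cg x; apply: continuousB; [exact: cf|exact: cg]. Qed.

Lemma within_continuous_opp (R : realType) (A : set R) (f : R -> R) :
  {within A, continuous f} -> {within A, continuous (fun t => - f t)}.
Proof. by move=> cf x; apply: continuousN; exact: cf. Qed.

Lemma within_continuous_cst (R : realType) (A : set R) (c : R) :
  {within A, continuous (fun=> c)}.
Proof. by apply: continuous_subspaceT => x; exact: cvg_cst. Qed.

Lemma within_continuous_scale (R : realType) (A : set R) (c : R) (f : R -> R) :
  {within A, continuous f} -> {within A, continuous (fun t => c * f t)}.
Proof. by apply: within_continuous_mul; exact: within_continuous_cst. Qed.

Lemma within_continuous_expR (R : realType) (A : set R) (f : R -> R) :
  {within A, continuous f} -> {within A, continuous (fun t => expR (f t))}.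
Proof.
move=> cf x; apply: continuous_comp; first exact: cf.
exact: continuous_expR.
Qed.

Lemma within_continuous_norm (R : realType) (A : set R) (f : R -> R) :
  {within A, continuous f} -> {within A, continuous (fun t => `|f t|)}.
Proof. by move=> cf x; apply: continuous_comp; [exact: cf|exact: norm_continuous]. Qed.

(** The comparison principle behind all energy estimates below: [g - f] is nondecreasing.
    Derivatives are required on the open interval only, since [toe_sol] provides no more. *)
Lemma ler_of_derive (R : realType) (T : R) (f g df dg : R -> R) :
  {within `[0, T], continuous f} -> {within `[0, T], continuous g} ->
  (forall t : R, 0 < t < T -> is_derive t 1 f (df t)) ->
  (forall t : R, 0 < t < T -> is_derive t 1 g (dg t)) ->
  (forall t : R, 0 < t < T -> df t <= dg t) -> f 0 <= g 0 ->
  forall t : R, 0 <= t <= T -> f t <= g t.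
Proof.
move=> cf cg hf hg le_d le0 t /andP[t0 tT].
have T0 : 0 <= T by exact: le_trans tT.
have hD x : 0 < x < T -> is_derive x 1 (g \- f) (dg x - df x).
  by move=> xT; have := hf x xT; have := hg x xT => ? ?; exact: is_deriveB.
have mono : {in `[0, T]%R &, {homo (g \- f) : x y / x <= y}}.
  apply: ger0_derive1_le_cc.
  - by move=> x; rewrite in_itv/= => /hD h; exact: ex_derive.
  - move=> x; rewrite in_itv/= => xT; have h := hD x xT.
    by rewrite derive1E derive_val subr_ge0 le_d.
  - exact: within_continuous_sub.
have := mono 0 t; rewrite !in_itv/= !lexx t0 tT T0 /= => /(_ isT isT isT).
lra.
Qed.

Lemma integral_primitive (R : realType) (T : R) (f : R -> R) : 0 < T ->
  {within `[0, T], continuous f} ->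
  let F := fun x => Rintegral lebesgue_measure `[0, x] f in
  [/\ F 0 = 0, {within `[0, T], continuous F} &
      forall t : R, 0 < t < T -> is_derive t 1 F (f t)].
Proof.
move=> T0 cf F.
have intf : lebesgue_measure.-integrable `[0, T] (EFin \o f).
  by apply: continuous_compact_integrable => //; exact: segment_compact.
split.
- by rewrite /F set_itv1 Rintegral_set1.
- exact: (parameterized_integral_continuous (ltW T0) intf).
- move=> t tT; have /andP[t0 tT'] := tT.
  have ct : {for t, continuous f}.
    by apply: (within_continuous_continuous T0 cf); rewrite in_itv.
  have [dF dFE] := continuous_FTC1_closed tT' intf t0 ct.
  by rewrite -dFE derive1E; apply: DeriveDef.
Qed.

Lemma within_continuous_bounded (R : realType) (T : R) (f : R -> R) : 0 <= T ->
  {within `[0, T], continuous f} ->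
  exists K, forall t : R, 0 <= t <= T -> `|f t| <= K.
Proof.
move=> T0 cf.
have [c _ hc] := EVT_max T0 (within_continuous_norm _ _ _ cf).
by exists `|f c| => t tT; apply: hc; rewrite in_itv.
Qed.

(** An epsilon/3 argument, at the geometric rate that the Picard iterates provide. *)
Lemma within_continuous_unif (R : realType) (T C : R) (y : R -> R) (S : nat -> R -> R) :
  (forall n, {within `[0, T], continuous (S n)}) ->
  (forall n (t : R), 0 <= t <= T -> `|y t - S n t| <= C * 2^-1 ^+ n) ->
  {within `[0, T], continuous y}.
Proof.
move=> cS hS; apply/subspace_continuousP => x xT.
apply/cvgrPdist_lt => e e0.
have /cvgrPdist_lt /(_ (e / 3)) : (fun n => C * 2^-1 ^+ n) @ \oo --> (0 : R).
  rewrite -(mulr0 C); apply: cvgMr; apply: cvg_expr.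
  by rewrite ger0_norm ?invr_ge0// invf_lt1 ?ltr1n.
case; [by rewrite divr_gt0|move=> n _ /(_ n (leqnn n)) /=; rewrite sub0r normrN => hn].
have {hn} hn : C * 2^-1 ^+ n < e / 3 by apply: le_lt_trans hn; exact: ler_norm.
have /subspace_continuousP /(_ x xT) /cvgrPdist_lt /(_ (e / 3)) := cS n.
move=> /(_ (divr_gt0 e0 (ltr0Sn _ _))).
apply: filter_app; near=> z => Hz.
have zT : `[0, T] z by near: z; exact: withinT.
have h1 := hS n x; have h2 := hS n z.
move: xT zT; rewrite /= !in_itv/= => /h1 {}h1 /h2 {}h2.
have -> : y x - y z = (y x - S n x) + (S n x - S n z) - (y z - S n z) by ring.
apply: le_lt_trans (ler_normB _ _) _.
apply: le_lt_trans (lerD (ler_normD _ _) (lexx _)) _.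
lra.
Unshelve. all: by end_near. Qed.

(** By telescoping, the intervals of radius [C 2^-n] about [u n] meet pairwise, so the supremum of
    their left ends lies in all of them. *)
Lemma sequence_limit_geometric (R : realType) (C : R) (u : nat -> R) :
  (forall n, `|u n.+1 - u n| <= C / 2 * 2^-1 ^+ n) ->
  exists l, forall n, `|l - u n| <= C * 2^-1 ^+ n.
Proof.
move=> hu.
have hk n k : `|u (n + k)%N - u n| <= C * 2^-1 ^+ n - C * 2^-1 ^+ (n + k).
  elim: k => [|k IH]; first by rewrite addn0 !subrr normr0.
  rewrite addnS -(subrKA (u (n + k)%N)).
  apply: le_trans (ler_normD _ _) _.
  have := hu (n + k)%N; rewrite [_ ^+ (n + k).+1]exprS.
  lra.
have C0 : 0 <= C.
  by have := le_trans (normr_ge0 _) (hu 0%N); rewrite expr0 mulr1; lra.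
have p0 n : 0 <= C * 2^-1 ^+ n :> R by rewrite mulr_ge0// exprn_ge0// invr_ge0.
have hle n m : u n - C * 2^-1 ^+ n <= u m + C * 2^-1 ^+ m.
  have [nm|/ltnW mn] := leqP n m.
    have := hk n (m - n)%N; rewrite subnKC// ler_norml => /andP[h1 _].
    by have := p0 m; move: h1; lra.
  have := hk m (n - m)%N; rewrite subnKC// ler_norml => /andP[_ h1].
  by have := p0 n; move: h1; lra.
pose E := [set u n - C * 2^-1 ^+ n | n in setT].
have E0 : E !=set0 by exists (u 0%N - C * 2^-1 ^+ 0), 0%N.
have ubE m : ubound E (u m + C * 2^-1 ^+ m) by move=> _ [n _ <-].
exists (sup E) => n; rewrite ler_distl; apply/andP; split.
  apply: ub_le_sup; first by exists (u 0%N + C * 2^-1 ^+ 0).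
  by exists n.
by apply: ge_sup.
Qed.

Lemma choice2 (A B C : Type) (P : A -> B -> C -> Prop) :
  (forall a b, exists c, P a b c) -> exists f, forall a b, P a b (f a b).
Proof.
move=> h; exists (fun a => projT1 (choice (h a))) => a.
exact: (projT2 (choice (h a))).
Qed.

(** Picard iteration started at the zero function. The system is real and indexed by any finite
    type, so that a complex system can be fed in through its real and imaginary parts. *)
Lemma linear_ode (R : realType) (I : finType) (T : R) (b : I -> I -> R -> R) (y0 : I -> R) :
  0 < T -> (forall i j, {within `[0, T], continuous (b i j)}) ->
  exists y : I -> R -> R,
  [/\ forall i, y i 0 = y0 i, forall i, {within `[0, T], continuous (y i)} &
      forall i (t : R), 0 < t < T -> is_derive t 1 (y i) (\sum_j b i j t * y j t)].
Proof.
move=> T0 cb.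
pose Phi (z : I -> R -> R) i t :=
  y0 i + Rintegral lebesgue_measure `[0, t] (fun s => \sum_j b i j s * z j s).
have PhiP z : (forall i, {within `[0, T], continuous (z i)}) ->
    [/\ forall i, Phi z i 0 = y0 i, forall i, {within `[0, T], continuous (Phi z i)} &
      forall i (t : R), 0 < t < T -> is_derive t 1 (Phi z i) (\sum_j b i j t * z j t)].
  move=> cz.
  have H i := integral_primitive _ T _ T0
    (within_continuous_sum _ _ (index_enum I) _ _ (fun j => within_continuous_mul _ _ _ _ (cb i j) (cz j))).
  split=> [i|i|i t tT]; have [h1 h2 h3] := H i.
  - by rewrite /Phi h1 addr0.
  - by apply: within_continuous_add; [exact: within_continuous_cst|exact: h2].
  - by have h := h3 t tT; rewrite -[X in is_derive _ _ _ X]add0r; exact: is_deriveD.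
have [B hB] : exists B : I -> I -> R, forall i j (t : R), 0 <= t <= T -> `|b i j t| <= B i j.
  have h i j : exists B : R, forall t : R, 0 <= t <= T -> `|b i j t| <= B.
    exact: within_continuous_bounded (ltW T0) (cb i j).
  exact: choice2 h.
have B0 i j : 0 <= B i j.
  by apply: le_trans (hB i j 0 _) => //; rewrite lexx ltW.
(* [K] dominates every row sum; the added 1 keeps it positive even for a vanishing system, so that
   it can be divided by. *)
pose K := 1 + \sum_i \sum_j B i j.
have hK i : \sum_j B i j <= K.
  rewrite /K [X in _ <= 1 + X](bigD1 i)//= addrCA lerDl addr_ge0//.
  by apply: sumr_ge0 => k _; exact: sumr_ge0.
have K1 : 1 <= K by rewrite /K lerDl; apply: sumr_ge0 => k _; exact: sumr_ge0.
pose M := \sum_i `|y0 i|.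
have M0 : 0 <= M by rewrite sumr_ge0.
have hM i : `|y0 i| <= M by rewrite /M (bigD1 i)//= lerDl sumr_ge0.
pose S n := iter n Phi (fun _ => cst 0).
have cS n i : {within `[0, T], continuous (S n i)}.
  elim: n i => [|n IH] i; first exact: within_continuous_cst.
  by have [_ /(_ i)] := PhiP _ IH.
have lin i (t c : R) (z w : I -> R -> R) : 0 <= t <= T ->
    (forall j, `|z j t - w j t| <= c) ->
    `|\sum_j b i j t * z j t - \sum_j b i j t * w j t| <= K * c.
  move=> tT hc; rewrite -sumrB; apply: le_trans (ler_norm_sum _ _ _) _.
  have c0 : 0 <= c by apply: le_trans (hc i).
  apply: (@le_trans _ _ (\sum_j B i j * c)); last by rewrite -mulr_suml ler_wpM2r.
  by apply: ler_sum => j _; rewrite -mulrBr normrM ler_pM ?hB.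
(* Transfers a bound through the Picard map: if [K |z - w|] stays below [g'], then [Phi z] and
   [Phi w] differ by at most [g]. *)
have cmp (z w : I -> R -> R) (g dg : R -> R) :
    (forall i, {within `[0, T], continuous (z i)}) ->
    (forall i, {within `[0, T], continuous (w i)}) ->
    {within `[0, T], continuous g} -> (forall t : R, 0 < t < T -> is_derive t 1 g (dg t)) ->
    0 <= g 0 -> (forall (t : R) j, 0 <= t <= T -> K * `|z j t - w j t| <= dg t) ->
    forall i (t : R), 0 <= t <= T -> `|Phi z i t - Phi w i t| <= g t.
  move=> cz cw cg hg g0 hzw i.
  have [z1 z2 z3] := PhiP _ cz; have [w1 w2 w3] := PhiP _ cw.
  have hd (t : R) : 0 < t < T ->
      `|\sum_j b i j t * z j t - \sum_j b i j t * w j t| <= dg t.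
    move=> /andP[/ltW t0 /ltW tT].
    apply: le_trans (lin i t (K^-1 * dg t) _ _ _ _) _; first by rewrite t0.
      move=> j; rewrite -(ler_pM2l (lt_le_trans ltr01 K1)) mulVKf ?hzw ?t0//.
      by rewrite gt_eqF// (lt_le_trans ltr01 K1).
    by rewrite mulVKf// gt_eqF// (lt_le_trans ltr01 K1).
  move=> t tT; rewrite ler_norml; apply/andP; split.
    rewrite lerNl opprB.
    apply: (ler_of_derive _ T (fun t => Phi w i t - Phi z i t) g
      (fun t => \sum_j b i j t * w j t - \sum_j b i j t * z j t) dg) => //.
    - exact: within_continuous_sub.
    - by move=> x xT; have := w3 i x xT; have := z3 i x xT => ? ?; exact: is_deriveB.
    - by move=> x /hd; rewrite distrC; exact: le_trans (ler_norm _).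
    - by rewrite z1 w1 subrr.
  apply: (ler_of_derive _ T (fun t => Phi z i t - Phi w i t) g
    (fun t => \sum_j b i j t * z j t - \sum_j b i j t * w j t) dg) => //.
  - exact: within_continuous_sub.
  - by move=> x xT; have := w3 i x xT; have := z3 i x xT => ? ?; exact: is_deriveB.
  - by move=> x /hd; exact: le_trans (ler_norm _).
  - by rewrite z1 w1 subrr.
have dexp (c : R) (t : R) :
    is_derive t 1 (fun t => c * expR (2 * K * t)) (c * (2 * K * expR (2 * K * t))).
  have h1 : is_derive t 1 (fun t : R => 2 * K * t) (2 * K).
    by rewrite -[X in is_derive _ _ _ X]mulr1; apply: is_deriveZ; exact: is_derive_id.
  have h2 := is_derive1_comp (is_derive_expR (2 * K * t)) h1.
  have := is_deriveZ c h2.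
  by rewrite [expR _ * _]mulrC; exact.
have cexp (c : R) : {within `[0, T], continuous (fun t => c * expR (2 * K * t))}.
  apply: within_continuous_scale; apply: within_continuous_expR; apply: within_continuous_scale.
  by apply: continuous_subspaceT => x; exact: cvg_id.
(* The weight [exp(2Kt)] turns the Picard map into a contraction of ratio 1/2. *)
have hS n i (t : R) : 0 <= t <= T ->
    `|S n.+1 i t - S n i t| <= (M * 2^-1 ^+ n) * expR (2 * K * t).
  elim: n i t => [|n IH] i t tT.
    rewrite /S /= /Phi subr0.
    rewrite (_ : (fun s => _) = cst 0); last first.
      by apply/funext => s; rewrite big1// => j _; rewrite mulr0.
    rewrite Rintegral_cst//= mul0r addr0 expr0 mulr1.
    apply: le_trans (hM i) _; rewrite ler_peMr// -expR0 ler_expR.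
    by rewrite !mulr_ge0// ?(le_trans ler01 K1)//; case/andP: tT.
  move: i t tT.
  apply: (cmp _ _ _ _ (cS n.+1) (cS n) (cexp _) (fun t _ => dexp (M * 2^-1 ^+ n.+1) t)).
  - by rewrite mulr_ge0 ?expR_ge0// mulr_ge0// exprn_ge0// invr_ge0.
  - move=> t j tT; apply: le_trans (ler_wpM2l _ (IH j t tT)) _; first by rewrite (le_trans ler01 K1).
    by rewrite exprS le_eqVlt; apply/orP; left; apply/eqP; field.
pose C := 2 * M * expR (2 * K * T).
have hS' n i (t : R) : 0 <= t <= T -> `|S n.+1 i t - S n i t| <= C / 2 * 2^-1 ^+ n.
  move=> tT; apply: le_trans (hS n i t tT) _.
  rewrite /C.
  have -> : 2 * M * expR (2 * K * T) / 2 * 2^-1 ^+ n = (M * 2^-1 ^+ n) * expR (2 * K * T) :> R.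
    by field.
  rewrite ler_wpM2l ?mulr_ge0 ?exprn_ge0 ?invr_ge0// ler_expR ler_wpM2l//.
    by rewrite mulr_ge0// (le_trans ler01 K1).
  by case/andP: tT.
have [y hy] : exists y : I -> R -> R, forall i (t : R), 0 <= t <= T ->
    forall n, `|y i t - S n i t| <= C * 2^-1 ^+ n.
  have h i (t : R) : exists l : R, 0 <= t <= T -> forall n, `|l - S n i t| <= C * 2^-1 ^+ n.
    have [tT|_] := boolP (0 <= t <= T); last by exists 0.
    have [l hl] := sequence_limit_geometric _ C (fun n => S n i t) (fun n => hS' n i t tT).
    by exists l.
  exact: choice2 h.
have cy i : {within `[0, T], continuous (y i)}.
  by apply: (within_continuous_unif _ _ C _ (fun n => S n i)) => // n t tT; exact: hy.
have [Z1 Z2 Z3] := PhiP _ cy.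
have yZ i (t : R) : 0 <= t <= T -> Phi y i t = y i t.
  (* Both sides are close to the iterate [S n.+1], so their distance is at most [(K C T + C) 2^-n]
     for every n. *)
  move=> tT; apply/eqP; rewrite -subr_eq0 -normr_eq0 eq_le normr_ge0 andbT.
  apply/ler_addgt0Pr => e e0; rewrite add0r.
  have C0 : 0 <= C by rewrite /C !mulr_ge0// expR_ge0.
  have [n hn] : exists n, (K * C * T + C) * 2^-1 ^+ n < e.
    have : (fun n => (K * C * T + C) * 2^-1 ^+ n) @ \oo --> (0 : R).
      rewrite -(mulr0 (K * C * T + C)); apply: cvgMr; apply: cvg_expr.
      by rewrite ger0_norm ?invr_ge0// invf_lt1 ?ltr1n.
    move=> /cvgrPdist_lt /(_ e e0) [n _ /(_ n (leqnn n))] /=.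
    by rewrite sub0r normrN => hn; exists n; exact: le_lt_trans (ler_norm _) hn.
  have h1 : `|Phi y i t - S n.+1 i t| <= (K * (C * 2^-1 ^+ n)) * t.
    move: i t tT; apply: (cmp y (S n) _ (fun=> K * (C * 2^-1 ^+ n))) => //.
    - by apply: within_continuous_scale; apply: continuous_subspaceT => x; exact: cvg_id.
    - move=> t _; rewrite -[X in is_derive _ _ _ X]mulr1.
      by apply: is_deriveZ; exact: is_derive_id.
    - by rewrite mulr0.
    - by move=> t j tT; rewrite ler_wpM2l ?hy// (le_trans ler01 K1).
  have h2 := hy i t tT n.+1.
  rewrite -(subrKA (S n.+1 i t)); apply: le_trans (ler_normD _ _) _.
  rewrite [X in _ + X]distrC; apply: le_trans (lerD h1 h2) _.
  apply: le_trans (ltW hn).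
  have p0 : 0 <= 2^-1 ^+ n :> R by rewrite exprn_ge0// invr_ge0.
  have -> : (K * C * T + C) * 2^-1 ^+ n =
    K * (C * 2^-1 ^+ n) * T + C * 2^-1 ^+ n by ring.
  rewrite lerD//.
    by rewrite ler_wpM2l ?(mulr_ge0, (le_trans ler01 K1))//; case/andP: tT.
  by rewrite exprS ler_wpM2l// ler_piMl// invf_le1 ?ler1n.
(* The witness is [Phi y], a primitive by construction; [y] is known to agree with it only on the
   segment. *)
exists (Phi y); split=> // i t tT.
have -> : \sum_j b i j t * Phi y j t = \sum_j b i j t * y j t.
  by apply: eq_bigr => j _; rewrite yZ//; case/andP: tT => /ltW -> /ltW ->.
exact: Z3.
Qed.

(** * Euclidean structure and largest eigenvalue *)

Lemma cabsE (R : realType) (z : R[i]) : cabs z = Normc.normc z.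
Proof. by case: z. Qed.

Lemma cabsM (R : realType) (z w : R[i]) : cabs (z * w) = cabs z * cabs w.
Proof. by rewrite !cabsE Normc.normcM. Qed.

Lemma cabsV (R : realType) (z : R[i]) : cabs z^-1 = (cabs z)^-1.
Proof. by rewrite !cabsE Normc.normcV. Qed.

Lemma cabs1 (R : realType) : cabs (1 : R[i]) = 1.
Proof. by rewrite cabsE Normc.normc1. Qed.

Lemma cabsN (R : realType) (z : R[i]) : cabs (- z) = cabs z.
Proof. by rewrite !cabsE normcN. Qed.

Lemma cabs_ge0 (R : realType) (z : R[i]) : 0 <= cabs z.
Proof. exact: sqrtr_ge0. Qed.

Lemma sqr_cabs (R : realType) (z : R[i]) : cabs z ^+ 2 = cabs2 z.
Proof. by rewrite sqr_sqrtr// addr_ge0// sqr_ge0. Qed.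

Lemma cabsD (R : realType) (z w : R[i]) : cabs (z + w) <= cabs z + cabs w.
Proof. by rewrite !cabsE le_normcD. Qed.

Lemma cabsX (R : realType) (z : R[i]) n : cabs (z ^+ n) = cabs z ^+ n.
Proof. by elim: n => [|n IH]; rewrite ?expr0 ?cabs1// !exprS cabsM IH. Qed.

Lemma cabs_real (R : realType) (x : R) : cabs x%:C = `|x|.
Proof. by rewrite /cabs /cabs2 /= expr0n/= addr0 sqrtr_sqr. Qed.

Lemma cabs_conj (R : realType) (z : R[i]) : cabs (conjc z) = cabs z.
Proof. by case: z => a b; rewrite /cabs /cabs2 /= sqrrN. Qed.

Lemma cabs_sum (R : realType) (I : Type) (r : seq I) (P : pred I) (f : I -> R[i]) :
  cabs (\sum_(i <- r | P i) f i) <= \sum_(i <- r | P i) cabs (f i).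
Proof.
elim/big_ind2: _ => [|a x b y ha hb|//]; first by rewrite (cabs_real _ 0) normr0.
exact: le_trans (cabsD _ _ _) (lerD ha hb).
Qed.

Lemma cReD (R : realType) (z w : R[i]) : complex.Re (z + w) = complex.Re z + complex.Re w.
Proof. by case: z; case: w. Qed.
Lemma cImD (R : realType) (z w : R[i]) : complex.Im (z + w) = complex.Im z + complex.Im w.
Proof. by case: z; case: w. Qed.
Lemma cReN (R : realType) (z : R[i]) : complex.Re (- z) = - complex.Re z.
Proof. by case: z. Qed.
Lemma cImN (R : realType) (z : R[i]) : complex.Im (- z) = - complex.Im z.
Proof. by case: z. Qed.
Lemma cReM (R : realType) (z w : R[i]) :
  complex.Re (z * w) = complex.Re z * complex.Re w - complex.Im z * complex.Im w.
Proof. by case: z; case: w. Qed.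
Lemma cImM (R : realType) (z w : R[i]) :
  complex.Im (z * w) = complex.Re z * complex.Im w + complex.Im z * complex.Re w.
Proof. by case: z; case: w. Qed.
Lemma cRe_sum (R : realType) (I : Type) (r : seq I) (P : pred I) (f : I -> R[i]) :
  complex.Re (\sum_(i <- r | P i) f i) = \sum_(i <- r | P i) complex.Re (f i).
Proof. by apply: (big_morph (@complex.Re R)) => //; exact: cReD. Qed.
Lemma cIm_sum (R : realType) (I : Type) (r : seq I) (P : pred I) (f : I -> R[i]) :
  complex.Im (\sum_(i <- r | P i) f i) = \sum_(i <- r | P i) complex.Im (f i).
Proof. by apply: (big_morph (@complex.Im R)) => //; exact: cImD. Qed.

Lemma cabs_le_ReIm (R : realType) (z : R[i]) :
  cabs z <= `|complex.Re z| + `|complex.Im z|.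
Proof.
rewrite -(ler_sqr (cabs_ge0 _ _)) ?nnegrE ?addr_ge0// sqr_cabs /cabs2.
rewrite sqrrD !real_normK ?num_real// addrAC lerDl.
by rewrite mulrn_wge0// mulr_ge0.
Qed.

(** The Euclidean inner product of C^n seen as a real space of dimension 2n: symmetric and real
    bilinear, so that energies can be differentiated over [R]. *)
Definition rdot {R : realType} {n} (u v : 'cV[R[i]]_n) : R :=
  complex.Re ((adjmx u *m v) 0 0).

Lemma rdotE (R : realType) n (u v : 'cV[R[i]]_n) : rdot u v =
  \sum_i (complex.Re (u i 0) * complex.Re (v i 0) + complex.Im (u i 0) * complex.Im (v i 0)).
Proof.
rewrite /rdot mxE cRe_sum; apply: eq_bigr => i _.
by rewrite !mxE cReM; case: (u i 0) => a b /=; rewrite mulNr opprK.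
Qed.

Lemma rdotC (R : realType) n (u v : 'cV[R[i]]_n) : rdot u v = rdot v u.
Proof. by rewrite !rdotE; apply: eq_bigr => i _; rewrite [X in X + _]mulrC [X in _ + X]mulrC. Qed.

Lemma rdotDr (R : realType) n (u v w : 'cV[R[i]]_n) :
  rdot u (v + w) = rdot u v + rdot u w.
Proof. by rewrite /rdot mulmxDr mxE cReD. Qed.

Lemma rdotDl (R : realType) n (u v w : 'cV[R[i]]_n) :
  rdot (v + w) u = rdot v u + rdot w u.
Proof. by rewrite rdotC rdotDr !(rdotC _ _ u). Qed.

Lemma rdotZr (R : realType) n (a : R) (u v : 'cV[R[i]]_n) :
  rdot u (a%:C *: v) = a * rdot u v.
Proof. by rewrite /rdot -scalemxAr mxE cReM /= mul0r subr0. Qed.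

Lemma rdotZl (R : realType) n (a : R) (u v : 'cV[R[i]]_n) :
  rdot (a%:C *: u) v = a * rdot u v.
Proof. by rewrite rdotC rdotZr rdotC. Qed.

Lemma rdotNr (R : realType) n (u v : 'cV[R[i]]_n) : rdot u (- v) = - rdot u v.
Proof. by rewrite /rdot mulmxN mxE cReN. Qed.

Lemma rdotNl (R : realType) n (u v : 'cV[R[i]]_n) : rdot (- u) v = - rdot u v.
Proof. by rewrite rdotC rdotNr rdotC. Qed.

Lemma rdot_ge0 (R : realType) n (v : 'cV[R[i]]_n) : 0 <= rdot v v.
Proof. by rewrite rdotE sumr_ge0// => i _; rewrite addr_ge0// -expr2 sqr_ge0. Qed.

Lemma vnormE (R : realType) n (v : 'cV[R[i]]_n) : vnorm v = Num.sqrt (rdot v v).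
Proof. by rewrite rdotE. Qed.

Lemma sqr_vnorm (R : realType) n (v : 'cV[R[i]]_n) : vnorm v ^+ 2 = rdot v v.
Proof. by rewrite vnormE sqr_sqrtr// rdot_ge0. Qed.

Lemma vnorm_ge0 (R : realType) n (v : 'cV[R[i]]_n) : 0 <= vnorm v.
Proof. exact: sqrtr_ge0. Qed.

Lemma vnorm_le (R : realType) n (v : 'cV[R[i]]_n) (c : R) :
  0 <= c -> (vnorm v <= c) = (rdot v v <= c ^+ 2).
Proof. by move=> c0; rewrite -sqr_vnorm ler_sqr ?nnegrE// vnorm_ge0. Qed.

(** Cauchy-Schwarz: expand [|s u - t v|^2 >= 0] at [s = |v|], [t = |u|]. If one norm vanishes, the
    expansion is affine in one parameter and bounded below, which forces the sign of its slope. *)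
Lemma rdot_le_vnorm (R : realType) n (u v : 'cV[R[i]]_n) :
  rdot u v <= vnorm u * vnorm v.
Proof.
set a := vnorm u; set b := vnorm v; set x := rdot u v.
have a0 : 0 <= a by exact: vnorm_ge0.
have b0 : 0 <= b by exact: vnorm_ge0.
have h (s t : R) : 0 <= s ^+ 2 * a ^+ 2 - 2 * s * t * x + t ^+ 2 * b ^+ 2.
  have := rdot_ge0 R n (s%:C *: u + (- t)%:C *: v).
  rewrite rdotDl !rdotDr !rdotZl !rdotZr -(sqr_vnorm _ _ u) -(sqr_vnorm _ _ v).
  rewrite (rdotC _ _ v u) -/x -/a -/b => /le_trans; apply.
  by rewrite le_eqVlt; apply/orP; left; apply/eqP; ring.
have z0 (c y : R) : (forall r : R, 0 <= c - 2 * r * y) -> y <= 0.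
  move=> hy; rewrite leNgt; apply/negP => y0; have := hy ((c + 1) / (2 * y)).
  have -> : 2 * ((c + 1) / (2 * y)) * y = c + 1 by field; rewrite gt_eqF.
  lra.
have [aE|ap] := eqVneq a 0.
  rewrite aE mul0r; apply: (z0 (b ^+ 2)) => r; have := h r 1.
  by rewrite aE; lra.
have [bE|bp] := eqVneq b 0.
  rewrite bE mulr0; apply: (z0 (a ^+ 2)) => r; have := h 1 r.
  by rewrite bE; lra.
have ab0 : 0 < a * b by rewrite mulr_gt0// lt0r ?ap ?bp ?a0 ?b0.
rewrite -(ler_pM2l ab0); have := h b a; lra.
Qed.

Lemma vnormD (R : realType) n (u v : 'cV[R[i]]_n) : vnorm (u + v) <= vnorm u + vnorm v.
Proof.
rewrite vnorm_le ?addr_ge0 ?vnorm_ge0//.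
rewrite rdotDl !rdotDr -!sqr_vnorm (rdotC _ _ v u).
have := rdot_le_vnorm R n u v; lra.
Qed.

Lemma vnormZ (R : realType) n (c : R[i]) (v : 'cV[R[i]]_n) : vnorm (c *: v) = cabs c * vnorm v.
Proof.
rewrite /vnorm /cabs -sqrtrM ?addr_ge0 ?sqr_ge0//; congr Num.sqrt.
rewrite mulr_sumr; apply: eq_bigr => i _.
by rewrite mxE -!sqr_cabs cabsM exprMn.
Qed.

Lemma vnormN (R : realType) n (v : 'cV[R[i]]_n) : vnorm (- v) = vnorm v.
Proof. by rewrite !vnormE rdotNl rdotNr opprK. Qed.

Lemma vnormB (R : realType) n (u v : 'cV[R[i]]_n) : vnorm (u - v) <= vnorm u + vnorm v.
Proof. by rewrite -(vnormN _ _ v) vnormD. Qed.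

Lemma vnorm0 (R : realType) n : vnorm (0 : 'cV[R[i]]_n) = 0.
Proof. by rewrite vnormE /rdot mulmx0 mxE sqrtr0. Qed.

Lemma vnorm_sum (R : realType) n (I : Type) (r : seq I) (P : pred I) (f : I -> 'cV[R[i]]_n) :
  vnorm (\sum_(i <- r | P i) f i) <= \sum_(i <- r | P i) vnorm (f i).
Proof.
elim/big_ind2: _ => [|a x b y ha hb|//]; first by rewrite vnorm0.
exact: le_trans (vnormD _ _ _ _) (lerD ha hb).
Qed.

Lemma specnorm_le (R : realType) m n (M : 'M[R[i]]_(m, n)) (c : R) :
  (forall v, vnorm v <= 1 -> vnorm (M *m v) <= c) -> specnorm M <= c.
Proof.
move=> h; apply: ge_sup.
  by exists (vnorm (M *m 0)), 0 => //=; rewrite vnorm0.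
by move=> _ [v /= hv <-]; exact: h.
Qed.

(** * Hermitian matrices, quadratic forms and Rayleigh quotients *)

Lemma adjmxM (R : realType) m n p (A : 'M[R[i]]_(m, n)) (B : 'M[R[i]]_(n, p)) :
  adjmx (A *m B) = adjmx B *m adjmx A.
Proof. by rewrite /adjmx map_mxM trmx_mul. Qed.

Lemma adjmxK (R : realType) m n (A : 'M[R[i]]_(m, n)) : adjmx (adjmx A) = A.
Proof. by apply/matrixP => i j; rewrite !mxE conjcK. Qed.

Lemma rdot_adj (R : realType) m n (M : 'M[R[i]]_(m, n)) u v :
  rdot u (M *m v) = rdot (adjmx M *m u) v.
Proof. by rewrite /rdot adjmxM adjmxK mulmxA. Qed.

Lemma rdot_hermC (R : realType) n (M : 'M[R[i]]_n) u v : is_hermitian M ->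
  rdot u (M *m v) = rdot v (M *m u).
Proof. by move=> hM; rewrite rdot_adj hM rdotC. Qed.

Lemma rdot_i (R : realType) n (u v : 'cV[R[i]]_n) :
  rdot u ('i *: v) = - rdot ('i *: u) v.
Proof.
rewrite !rdotE -sumrN; apply: eq_bigr => i _; rewrite !mxE !cReM !cImM /=; ring.
Qed.

(** ['i] is skew for [rdot] and [M] is symmetric, so their product is skew. Hence the Hamiltonian
    part of a generator never enters an energy balance. *)
Lemma rdot_herm_i (R : realType) n (M : 'M[R[i]]_n) v : is_hermitian M ->
  rdot v ('i *: (M *m v)) = 0.
Proof.
move=> hM; have := rdot_i R n v (M *m v).
by rewrite (rdot_hermC _ _ M ('i *: v))// -scalemxAr; lra.
Qed.

Lemma psd_rdot (R : realType) n (M : 'M[R[i]]_n) v : psd M -> 0 <= rdot v (M *m v).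
Proof.
move=> /(_ v); rewrite /rdot mulmxA lecE /= => /andP[_]; exact.
Qed.

(** The form of [M] at [u - v], expanded. *)
Lemma psd_cauchy (R : realType) n (M : 'M[R[i]]_n) u v : is_hermitian M -> psd M ->
  2 * rdot u (M *m v) <= rdot u (M *m u) + rdot v (M *m v).
Proof.
move=> hM pM; have := psd_rdot R n M (u - v) pM.
move: (rdot_hermC R n M v u hM); rewrite (mulmxBr M u v).
move: (M *m u) (M *m v) => a b hab.
rewrite rdotDl !rdotDr !rdotNl !rdotNr; lra.
Qed.

Lemma hermitian_hermsymmx (R : realType) n (M : 'M[R[i]]_n) : is_hermitian M -> M \is hermsymmx.
Proof.
by move=> hM; apply/is_hermitianmxP; rewrite expr0 scale1r -[LHS]hM /adjmx map_trmx.
Qed.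

Lemma hermitian_diag (R : realType) n (M : 'M[R[i]]_n) : is_hermitian M ->
  exists (P : 'M[R[i]]_n) (d : 'I_n -> R),
  [/\ forall v, rdot (P *m v) (P *m v) = rdot v v,
      forall v, rdot v (M *m v) = \sum_i d i * cabs2 ((P *m v) i 0) &
      forall i, eigenvalue M (d i)%:C].
Proof.
move=> hM; have hh := hermitian_hermsymmx R n M hM.
have Mn := hermitian_normalmx hh.
have PU := spectral_unitarymx M.
have /orthomx_spectralP ME := Mn.
have dr := hermitian_spectral_diag_real hh.
move: ME PU dr; set P := spectralmx M; set sp := spectral_diag M => ME PU dr.
have iP : invmx P = adjmx P by rewrite (invmx_unitary PU) /adjmx map_trmx.
have Pu := unitarymx_unit PU.
have PP : adjmx P *m P = 1%:M by rewrite -iP mulVmx.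
have spE i : sp 0 i = (complex.Re (sp 0 i))%:C.
  have /mxOverP /(_ 0 i) := dr; move=> /complex_realP [k ->] //.
exists P, (fun i => complex.Re (sp 0 i)); split.
- by move=> v; rewrite rdot_adj mulmxA PP mul1mx.
- move=> v; rewrite {1}ME iP -!mulmxA rdot_adj adjmxK rdotE.
  move: (P *m v) => w; apply: eq_bigr => i _.
  rewrite mul_diag_mx mxE spE cReM cImM /= /cabs2; ring.
(* [eigenvalue] refers to row vectors, so the eigenvectors are the rows of the diagonalising unitary
   [P]. *)
- move=> i; rewrite -spE; apply/eigenvalueP; exists (row i P).
    rewrite {1}ME !mulmxA -row_mul mulmxV// -!row_mul mul1mx.
    by apply/rowP => j; rewrite mul_diag_mx !mxE.
  apply/eqP => r0.
  have := congr1 (fun A => row i A) (mulmxV Pu); rewrite row_mul r0 mul0mx.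
  move=> /rowP /(_ i); rewrite !mxE eqxx => /eqP.
  by rewrite eq_sym oner_eq0.
Qed.

Lemma rdot_gt0 (R : realType) n (v : 'cV[R[i]]_n) : v != 0 -> 0 < rdot v v.
Proof.
move=> v0; rewrite lt0r rdot_ge0 andbT; apply: contra_neq v0.
rewrite rdotE => /eqP; rewrite psumr_eq0 => [/allP h|i _]; last first.
  by rewrite -!expr2 addr_ge0 ?sqr_ge0.
apply/matrixP => i j; rewrite ord1 mxE.
have := h i (mem_index_enum _); rewrite /= paddr_eq0 -?expr2 ?sqr_ge0//.
by rewrite !sqrf_eq0 => /andP[/eqP a /eqP b]; case: (v i 0) a b => x y /= -> ->.
Qed.

(** The adjoint of a row eigenvector is a column eigenvector, as [M] is Hermitian and [x] real. *)
Lemma eigenvalue_rdot (R : realType) n (M : 'M[R[i]]_n) (x : R) : is_hermitian M ->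
  eigenvalue M x%:C -> exists2 v, 0 < rdot v v & rdot v (M *m v) = x * rdot v v.
Proof.
move=> hM /eigenvalueP [u uM u0]; exists (adjmx u).
  apply: rdot_gt0; apply: contra_neq u0 => /(congr1 (@adjmx R _ _)).
  by rewrite adjmxK => ->; apply/matrixP => i j; rewrite !mxE conjc0.
rewrite -rdotZr -{1}hM -adjmxM uM; congr (rdot _ _).
by apply/matrixP => i j; rewrite !mxE rmorphM /= oppr0.
Qed.

(** Ensures that the supremum defining [lambda_max] is a genuine one. *)
Lemma has_sup_eigenvalue (R : realType) n (M : 'M[R[i]]_n) : (0 < n)%N -> is_hermitian M ->
  has_sup [set x : R | eigenvalue M x%:C].
Proof.
move=> n0 hM; have [P [d [PP Md ed]]] := hermitian_diag R n M hM.
split; first by exists (d (Ordinal n0)); exact: ed.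
exists (\sum_i `|d i|) => x /= /(eigenvalue_rdot R n M x hM) [v vp xE].
rewrite -(ler_pM2r vp) -xE Md -PP rdotE mulr_sumr.
apply: ler_sum => i _; rewrite /cabs2 -!expr2 ler_wpM2r ?addr_ge0 ?sqr_ge0//.
by apply: le_trans (ler_norm _) _; rewrite (bigD1 i)//= lerDl sumr_ge0.
Qed.

Lemma rdot_le_lambda_max (R : realType) n (M : 'M[R[i]]_n) v : is_hermitian M ->
  rdot v (M *m v) <= lambda_max M * rdot v v.
Proof.
case: n M v => [|n] M v hM; first by rewrite /rdot !mxE !big_ord0 mulr0.
have [P [d [PP Md ed]]] := hermitian_diag R _ M hM.
rewrite Md -PP rdotE mulr_sumr; apply: ler_sum => i _.
rewrite /cabs2 -!expr2 ler_wpM2r ?addr_ge0 ?sqr_ge0//.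
apply: sup_upper_bound; last exact: ed.
exact: has_sup_eigenvalue.
Qed.

Lemma lambda_max_le (R : realType) n (M : 'M[R[i]]_n) (c : R) : (0 < n)%N -> is_hermitian M ->
  (forall v, rdot v (M *m v) <= c * rdot v v) -> lambda_max M <= c.
Proof.
move=> n0 hM h; apply: ge_sup; first by have [] := has_sup_eigenvalue R n M n0 hM.
move=> x /= /(eigenvalue_rdot R n M x hM) [v vp xE].
by rewrite -(ler_pM2r vp) -xE.
Qed.

(** In dimension 0 there is no eigenvalue, and the supremum of the empty set is 0 by default. *)
Lemma lambda_max_mx0 (R : realType) (M : 'M[R[i]]_0) : lambda_max M = 0.
Proof.
rewrite /lambda_max (_ : mkset _ = set0) ?sup0//.
by apply/seteqP; split => // x /= /eigenvalueP [u _]; rewrite thinmx0 eqxx.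
Qed.

Lemma lambda_max_ge0 (R : realType) n (M : 'M[R[i]]_n) : is_hermitian M -> psd M ->
  0 <= lambda_max M.
Proof.
case: n M => [|n] M hM pM; first by rewrite lambda_max_mx0.
have v0 : const_mx 1 != 0 :> 'cV[R[i]]_n.+1.
  by apply/eqP => /matrixP /(_ 0 0); rewrite !mxE; apply/eqP; rewrite oner_eq0.
rewrite -(pmulr_lge0 _ (rdot_gt0 _ _ _ v0)).
exact: le_trans (psd_rdot _ _ _ _ pM) (rdot_le_lambda_max _ _ _ _ hM).
Qed.

(** A crude entrywise bound, sufficient for the continuity of [lambda_max]. *)
Lemma rdot_mx_le (R : realType) n (M : 'M[R[i]]_n) v :
  rdot v (M *m v) <= (\sum_i \sum_j cabs (M i j)) * rdot v v.
Proof.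
have hv i : cabs (v i 0) <= vnorm v.
  rewrite /vnorm /cabs ler_sqrt; last by rewrite sumr_ge0// => j _; rewrite addr_ge0 ?sqr_ge0.
  by rewrite (bigD1 i)//= lerDl sumr_ge0// => j _; rewrite addr_ge0 ?sqr_ge0.
apply: le_trans (rdot_le_vnorm _ _ _ _) _.
rewrite -sqr_vnorm [X in _ <= _ * X]expr2 [X in _ <= X]mulrA [X in _ <= X]mulrC.
rewrite ler_wpM2l ?vnorm_ge0//.
(* [M v] is split into its coordinate vectors, to which the triangle inequality applies. *)
have -> : M *m v = \sum_i \col_k ((i == k)%:R * \sum_j M i j * v j 0).
  apply/matrixP => k l; rewrite ord1 summxE [RHS](bigD1 k)//= !mxE eqxx mul1r.
  rewrite [X in _ + X]big1 ?addr0//.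
  by move=> j jk; rewrite !mxE (negPf jk) mul0r.
apply: le_trans (vnorm_sum _ _ _ _ _ _) _; rewrite mulr_suml.
apply: ler_sum => i _.
have -> : vnorm (\col_k ((i == k)%:R * \sum_j M i j * v j 0)) = cabs (\sum_j M i j * v j 0).
  move: (\sum_j _) => s.
  rewrite /vnorm /cabs (bigD1 i)//= !mxE eqxx mul1r big1 ?addr0// => j ji.
  by rewrite !mxE eq_sym (negPf ji) mul0r /cabs2 /= expr0n/= addr0.
apply: le_trans (cabs_sum _ _ _ _ _) _; rewrite mulr_suml.
by apply: ler_sum => j _; rewrite cabsM ler_wpM2l ?cabs_ge0.
Qed.

(** Rayleigh quotients: the form of [A] is that of [B] plus that of [A - B], and the two are bounded
    separately. *)
Lemma lambda_max_lipschitz (R : realType) n (A B : 'M[R[i]]_n) :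
  is_hermitian A -> is_hermitian B ->
  `|lambda_max A - lambda_max B| <= \sum_i \sum_j cabs (A i j - B i j).
Proof.
have key (A' B' : 'M[R[i]]_n) : is_hermitian A' -> is_hermitian B' ->
    lambda_max A' <= lambda_max B' + \sum_i \sum_j cabs (A' i j - B' i j).
  move=> hA hB; case: (posnP n) => n0.
    subst n; rewrite !lambda_max_mx0 add0r.
    by rewrite sumr_ge0// => i _; rewrite sumr_ge0// => j _; exact: cabs_ge0.
  apply: lambda_max_le => // v; rewrite -{1}(subrK B' A') mulmxDl rdotDr addrC mulrDl.
  rewrite lerD ?rdot_le_lambda_max//; apply: le_trans (rdot_mx_le _ _ _ _) _.
  rewrite le_eqVlt; apply/orP; left; apply/eqP; congr (_ * _).
  by apply: eq_bigr => i _; apply: eq_bigr => j _; rewrite !mxE.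
move=> hA hB; rewrite ler_distl; apply/andP; split.
  rewrite lerBlDr; apply: le_trans (key B A hB hA) _.
  rewrite lerD2l; apply: ler_sum => i _; apply: ler_sum => j _.
  by rewrite -cabsN opprB.
exact: key.
Qed.

(** The variation of [lambda_max] is squeezed by the continuous function [g], which vanishes at [x].
    Continuity makes the integral of [lambda_max] usable as a Gronwall exponent. *)
Lemma continuous_lambda_max (R : realType) n (T : R) (L : R -> 'M[R[i]]_n) :
  mx_cont_on T L -> (forall t : R, 0 <= t <= T -> is_hermitian (L t)) ->
  {within `[0, T], continuous (fun t => lambda_max (L t))}.
Proof.
move=> cL hL; apply/subspace_continuousP => x xT.
have xT' : 0 <= x <= T by move: xT; rewrite /= in_itv.
pose g (t : R) := \sum_i \sum_j (`|complex.Re (L t i j) - complex.Re (L x i j)| +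
  `|complex.Im (L t i j) - complex.Im (L x i j)|).
have cg : {within `[0, T], continuous g}.
  apply: within_continuous_sum => i; apply: within_continuous_sum => j.
  have [c1 c2] := cL i j.
  by apply: within_continuous_add; apply: within_continuous_norm;
    apply: within_continuous_sub => //; exact: within_continuous_cst.
have g0 : g x = 0.
  by apply: big1 => i _; apply: big1 => j _; rewrite !subrr normr0 addr0.
move/subspace_continuousP : cg => /(_ x xT) /cvgrPdist_lt cg.
apply/cvgrPdist_lt => e e0; have := cg e e0.
apply: filter_app; near=> t => ht; have {}ht : `|g x - g t| < e := ht; rewrite g0 in ht.
have tT : `[0, T] t by near: t; exact: withinT.
rewrite /= in_itv/= in tT.
rewrite distrC; apply: le_lt_trans ht; apply: le_trans (lambda_max_lipschitz _ _ _ _ (hL _ tT) (hL _ xT')) _.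
rewrite sub0r normrN; apply: le_trans (ler_norm _).
apply: ler_sum => i _; apply: ler_sum => j _.
by apply: le_trans (cabs_le_ReIm _ _) _; rewrite cReD cImD cReN cImN.
Unshelve. all: by end_near. Qed.

(** * Time-ordered exponentials *)

Lemma is_derive_bigsum (R : realType) (I : Type) (r : seq I) (f : I -> R -> R) (df : I -> R) (t : R) :
  (forall i, is_derive t 1 (f i) (df i)) ->
  is_derive t 1 (fun x => \sum_(i <- r) f i x) (\sum_(i <- r) df i).
Proof.
move=> h; elim: r => [|i r IH].
  have -> : (fun x => \sum_(i <- [::]) f i x) = cst 0.
    by apply/funext => x; rewrite big_nil.
  by rewrite big_nil; exact: is_derive_cst.
have -> : (fun x => \sum_(j <- i :: r) f j x) = (f i \+ fun x => \sum_(j <- r) f j x).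
  by apply/funext => x; rewrite big_cons.
by rewrite big_cons; have := h i => ?; exact: is_deriveD.
Qed.

Lemma is_deriveMc (R : realType) (c : R) (f : R -> R) (df t : R) :
  is_derive t 1 f df -> is_derive t 1 (fun x => c * f x) (c * df).
Proof. by move=> h; exact: is_deriveZ. Qed.

Lemma is_derive_sqr (R : realType) (f : R -> R) (df t : R) :
  is_derive t 1 f df -> is_derive t 1 (fun x => f x * f x) (2 * (f t * df)).
Proof.
move=> h; rewrite (_ : 2 * _ = f t *: df + f t *: df); first exact: is_deriveM.
by rewrite /GRing.scale/=; ring.
Qed.

Lemma is_derive_expRM (R : realType) (f : R -> R) (df t : R) :
  is_derive t 1 f df -> is_derive t 1 (fun x => expR (f x)) (df * expR (f t)).
Proof.
by move=> h; rewrite mulrC; exact: (is_derive1_comp (is_derive_expR (f t)) h).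
Qed.

(** [f] times the integrating factor [exp (- F)] is nonincreasing. The rate depends on time, which
    is what produces the integral [eta_max] in place of [T] times a maximum. *)
Lemma gronwall (R : realType) (T : R) (f df lam : R -> R) : 0 < T ->
  {within `[0, T], continuous f} -> {within `[0, T], continuous lam} ->
  (forall t : R, 0 < t < T -> is_derive t 1 f (df t)) ->
  (forall t : R, 0 < t < T -> df t <= lam t * f t) ->
  f T <= expR (Rintegral lebesgue_measure `[0, T] lam) * f 0.
Proof.
move=> T0 cf cl hf hle.
have [I0 cI dI] := integral_primitive _ _ _ T0 cl.
set F := fun x => Rintegral _ _ _ in I0 cI dI.
have F0 : F 0 = 0 := I0.
have cE : {within `[0, T], continuous (fun t => expR (- F t))}.
  by apply: within_continuous_expR; exact: within_continuous_opp.
have := ler_of_derive _ T (fun t => f t * expR (- F t)) (fun=> f 0)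
   (fun t => expR (- F t) * (df t - lam t * f t)) (fun=> 0).
move=> /(_ (within_continuous_mul _ _ _ _ cf cE) (within_continuous_cst _ _ _)).
have H1 (t : R) : 0 < t < T ->
    is_derive t 1 (fun t0 => f t0 * expR (- F t0)) (expR (- F t) * (df t - lam t * f t)).
  move=> tT; have h1 := hf t tT; have h2 := is_derive_expRM _ _ _ _ (is_deriveN (dI t tT)).
  rewrite (_ : expR _ * _ = f t *: (- lam t * expR (- F t)) + expR (- F t) *: df t).
    exact: is_deriveM.
  by rewrite /GRing.scale/=; ring.
move=> /(_ H1 (fun t _ => is_derive_cst _ _ _)).
have H2 (t : R) : 0 < t < T -> expR (- F t) * (df t - lam t * f t) <= 0.
  by move=> tT; rewrite pmulr_rle0 ?expR_gt0// subr_le0 hle.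
move=> /(_ H2); rewrite F0 oppr0 expR0 mulr1 => /(_ (lexx _) T).
rewrite lexx ltW// => /(_ isT).
by rewrite expRN -ler_pdivlMr ?invr_gt0 ?expR_gt0// invrK mulrC.
Qed.

Lemma eq_within_continuous {R : realType} {A : set R} {f g : R -> R} :
  f =1 g -> {within A, continuous f} -> {within A, continuous g}.
Proof. by move=> /funext ->. Qed.

Lemma eq_is_derive {R : realType} {f g : R -> R} {t df dg : R} :
  f =1 g -> df = dg -> is_derive t 1 f df -> is_derive t 1 g dg.
Proof. by move=> /funext -> ->. Qed.

(** The column analogue of [toe_sol] with a free right-hand side, so that solutions of different
    equations can be combined linearly. *)
Definition vderiv {R : realType} {n} (T : R) (psi dpsi : R -> 'cV[R[i]]_n) : Prop :=
  (forall i, {within `[0, T], continuous (fun t : R => complex.Re (psi t i 0))} /\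
             {within `[0, T], continuous (fun t : R => complex.Im (psi t i 0))}) /\
  (forall t : R, 0 < t < T -> forall i,
     is_derive t 1 (fun s : R => complex.Re (psi s i 0)) (complex.Re (dpsi t i 0)) /\
     is_derive t 1 (fun s : R => complex.Im (psi s i 0)) (complex.Im (dpsi t i 0))).

Lemma eq_vderiv {R : realType} {n} {T : R} {f df g dg : R -> 'cV[R[i]]_n} :
  f =1 g -> df =1 dg -> vderiv T f df -> vderiv T g dg.
Proof. by move=> /funext -> /funext ->. Qed.

Lemma vderivD (R : realType) n (T : R) (f df g dg : R -> 'cV[R[i]]_n) :
  vderiv T f df -> vderiv T g dg ->
  vderiv T (fun t => f t + g t) (fun t => df t + dg t).
Proof.
move=> [cf hf] [cg hg]; split=> [i|t tT i].
  have [c1 c2] := cf i; have [d1 d2] := cg i; split.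
    by apply: eq_within_continuous _ (within_continuous_add _ _ _ _ c1 d1) => t; rewrite mxE cReD.
  by apply: eq_within_continuous _ (within_continuous_add _ _ _ _ c2 d2) => t; rewrite mxE cImD.
have [c1 c2] := hf t tT i; have [d1 d2] := hg t tT i; split.
  by apply: eq_is_derive _ _ (is_deriveD c1 d1) => [x|]; rewrite mxE cReD.
by apply: eq_is_derive _ _ (is_deriveD c2 d2) => [x|]; rewrite mxE cImD.
Qed.

Lemma vderivZ (R : realType) n (T : R) (c : R[i]) (f df : R -> 'cV[R[i]]_n) :
  vderiv T f df -> vderiv T (fun t => c *: f t) (fun t => c *: df t).
Proof.
move=> [cf hf]; split=> [i|t tT i].
  have [c1 c2] := cf i; split.
    by apply: eq_within_continuous _ (within_continuous_sub _ _ _ _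
      (within_continuous_scale _ _ (complex.Re c) _ c1)
      (within_continuous_scale _ _ (complex.Im c) _ c2)) => t; rewrite mxE cReM.
  by apply: eq_within_continuous _ (within_continuous_add _ _ _ _
    (within_continuous_scale _ _ (complex.Re c) _ c2)
    (within_continuous_scale _ _ (complex.Im c) _ c1)) => t; rewrite mxE cImM.
have [d1 d2] := hf t tT i; split.
  by apply: eq_is_derive _ _ (is_deriveB (is_deriveMc _ (complex.Re c) _ _ _ d1)
    (is_deriveMc _ (complex.Im c) _ _ _ d2)) => [x|]; rewrite mxE cReM.
by apply: eq_is_derive _ _ (is_deriveD (is_deriveMc _ (complex.Re c) _ _ _ d2)
  (is_deriveMc _ (complex.Im c) _ _ _ d1)) => [x|]; rewrite mxE cImM.
Qed.

Lemma vderiv0 (R : realType) n (T : R) : vderiv T (fun=> 0 : 'cV[R[i]]_n) (fun=> 0).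
Proof.
split=> [i|t tT i]; rewrite mxE; split; by
  [exact: within_continuous_cst|exact: is_derive_cst].
Qed.

Lemma vderiv_sum (R : realType) n (T : R) (I : Type) (r : seq I) (f df : I -> R -> 'cV[R[i]]_n) :
  (forall i, vderiv T (f i) (df i)) ->
  vderiv T (fun t => \sum_(i <- r) f i t) (fun t => \sum_(i <- r) df i t).
Proof.
move=> h; elim: r => [|i r IH].
  by apply: eq_vderiv _ _ (vderiv0 R n T) => t; rewrite big_nil.
by apply: eq_vderiv _ _ (vderivD _ _ _ _ _ _ _ (h i) IH) => t; rewrite big_cons.
Qed.

Lemma vderivB (R : realType) n (T : R) (f df g dg : R -> 'cV[R[i]]_n) :
  vderiv T f df -> vderiv T g dg ->
  vderiv T (fun t => f t - g t) (fun t => df t - dg t).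
Proof.
move=> hf hg.
by apply: eq_vderiv _ _ (vderivD _ _ _ _ _ _ _ hf (vderivZ _ _ _ (-1) _ _ hg)) => t;
  rewrite scaleN1r.
Qed.

Lemma vderiv_rdot (R : realType) n (T : R) (f df : R -> 'cV[R[i]]_n) : vderiv T f df ->
  {within `[0, T], continuous (fun t => rdot (f t) (f t))} /\
  forall t : R, 0 < t < T ->
    is_derive t 1 (fun s => rdot (f s) (f s)) (2 * rdot (f t) (df t)).
Proof.
move=> [cf hf]; split=> [|t tT].
  apply: (@eq_within_continuous _ _ (fun t => \sum_i
    (complex.Re (f t i 0) * complex.Re (f t i 0) + complex.Im (f t i 0) * complex.Im (f t i 0)))).
    by move=> t; rewrite rdotE.
  apply: within_continuous_sum => i; have [c1 c2] := cf i.
  by apply: within_continuous_add; exact: within_continuous_mul.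
apply: (@eq_is_derive _ (fun t => \sum_i
    (complex.Re (f t i 0) * complex.Re (f t i 0) + complex.Im (f t i 0) * complex.Im (f t i 0)))
  _ _ (\sum_i (2 * (complex.Re (f t i 0) * complex.Re (df t i 0)) +
               2 * (complex.Im (f t i 0) * complex.Im (df t i 0))))).
- by move=> s; rewrite rdotE.
- by rewrite rdotE mulr_sumr; apply: eq_bigr => i _; rewrite mulrDr.
apply: is_derive_bigsum => i; have [d1 d2] := hf t tT i.
have h1 := is_derive_sqr _ _ _ _ d1; have h2 := is_derive_sqr _ _ _ _ d2.
exact: is_deriveD.
Qed.

Lemma toe_sol_vderiv (R : realType) n (T : R) (B V : R -> 'M[R[i]]_n) (v : 'cV[R[i]]_n) :
  toe_sol B T V -> vderiv T (fun t => V t *m v) (fun t => - (B t *m (V t *m v))).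
Proof.
move=> [_ [cV dV]].
have E M : \sum_j v j 0 *: col j M = M *m v :> 'cV[R[i]]_n.
  apply/matrixP => i k; rewrite ord1 mxE summxE; apply: eq_bigr => j _.
  by rewrite !mxE mulrC.
have h j : vderiv T (fun t => v j 0 *: col j (V t))
    (fun t => v j 0 *: col j (- (B t *m V t))).
  apply: vderivZ; split=> [i|t tT i].
    have [c1 c2] := cV i j; split.
      by apply: eq_within_continuous _ c1 => t; rewrite mxE.
    by apply: eq_within_continuous _ c2 => t; rewrite mxE.
  have [c1 c2] := dV t tT i j; split.
    by apply: eq_is_derive _ _ c1 => [x|]; rewrite [col _ _ _ _]mxE.
  by apply: eq_is_derive _ _ c2 => [x|]; rewrite [col _ _ _ _]mxE.
apply: eq_vderiv _ _ (vderiv_sum _ _ _ _ (index_enum _) _ _ h) => t; rewrite E//.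
by rewrite mulNmx mulmxA.
Qed.

Lemma mx_cont_onD (R : realType) n (T : R) (A B : R -> 'M[R[i]]_n) :
  mx_cont_on T A -> mx_cont_on T B -> mx_cont_on T (fun t => A t + B t).
Proof.
move=> cA cB i j; have [c1 c2] := cA i j; have [d1 d2] := cB i j; split.
  by apply: eq_within_continuous _ (within_continuous_add _ _ _ _ c1 d1) => t; rewrite mxE cReD.
by apply: eq_within_continuous _ (within_continuous_add _ _ _ _ c2 d2) => t; rewrite mxE cImD.
Qed.

Lemma mx_cont_onZ (R : realType) n (T : R) (c : R[i]) (A : R -> 'M[R[i]]_n) :
  mx_cont_on T A -> mx_cont_on T (fun t => c *: A t).
Proof.
move=> cA i j; have [c1 c2] := cA i j; split.
  by apply: eq_within_continuous _ (within_continuous_sub _ _ _ _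
    (within_continuous_scale _ _ (complex.Re c) _ c1)
    (within_continuous_scale _ _ (complex.Im c) _ c2)) => t; rewrite mxE cReM.
by apply: eq_within_continuous _ (within_continuous_add _ _ _ _
  (within_continuous_scale _ _ (complex.Re c) _ c2)
  (within_continuous_scale _ _ (complex.Im c) _ c1)) => t; rewrite mxE cImM.
Qed.

Lemma toe_sol_exists (R : realType) n (T : R) (B : R -> 'M[R[i]]_n) : 0 < T ->
  mx_cont_on T B -> exists V, toe_sol B T V.
Proof.
move=> T0 cB.
(* The real form of [- B]: [(i, true)] and [(i, false)] index the real and imaginary parts of
   coordinate [i]. Each column of the solution is obtained separately. *)
pose b (p q : 'I_n * bool) (t : R) : R :=
  let z := B t p.1 q.1 in
  match p.2, q.2 with
  | true, true => - complex.Re z | true, false => complex.Im z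
  | false, true => - complex.Im z | false, false => - complex.Re z
  end.
have cb p q : {within `[0, T], continuous (b p q)}.
  case: p q => [i [|]] [k [|]]; have [c1 c2] := cB i k; rewrite /b /=;
    by [exact: within_continuous_opp|exact: c2|exact: c1].
pose y0 (j : 'I_n) (p : 'I_n * bool) : R := if p.2 then (p.1 == j)%:R else 0.
have hy j := linear_ode _ _ _ b (y0 j) T0 cb.
have [y hy'] := choice hy.
exists (fun t => \matrix_(i, j) (y j (i, true) t +i* y j (i, false) t)).
have Eb j i c t : \sum_q b (i, c) q t * y j q t =
    if c then complex.Re ((- (B t *m \matrix_(i, j) (y j (i, true) t +i* y j (i, false) t))) i j)
    else complex.Im ((- (B t *m \matrix_(i, j) (y j (i, true) t +i* y j (i, false) t))) i j).
  rewrite (eq_bigr (fun q : 'I_n * bool => b (i, c) (q.1, q.2) t * y j (q.1, q.2) t)); last by case.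
  rewrite -(pair_bigA _ (fun k d => b (i, c) (k, d) t * y j (k, d) t)) /=.
  rewrite !mxE cReN cImN cRe_sum cIm_sum -!sumrN.
  case: c; apply: eq_bigr => k _; rewrite big_bool /b /= !mxE.
    by rewrite cReM /=; ring.
  by rewrite cImM /=; ring.
split; [|split].
- apply/matrixP => i j; rewrite !mxE; have [h _ _] := hy' j.
  by rewrite !h /y0 /=; case: eqP.
- move=> i j; have [_ h _] := hy' j; split.
    by apply: eq_within_continuous _ (h (i, true)) => t; rewrite mxE.
  by apply: eq_within_continuous _ (h (i, false)) => t; rewrite mxE.
- move=> t tT i j; have [_ _ h] := hy' j; split.
    by apply: eq_is_derive _ _ (h (i, true) t tT) => [x|]; [rewrite mxE|exact: (Eb j i true t)].
  by apply: eq_is_derive _ _ (h (i, false) t tT) => [x|]; [rewrite mxE|exact: (Eb j i false t)].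
Qed.

(* [texp] selects an unspecified solution.  All estimates below hold for every
   solution, so uniqueness is never needed. *)
Lemma texp_sol (R : realType) n (T : R) (B : R -> 'M[R[i]]_n) : 0 < T ->
  mx_cont_on T B -> exists2 V, toe_sol B T V & texp B T = V T.
Proof.
move=> T0 cB; have [V0 hV0] := toe_sol_exists _ _ _ _ T0 cB.
have : [set M | exists V, toe_sol B T V /\ V T = M] !=set0 by exists (V0 T), V0.
by move=> /(xgetPex 0) [V [hV VT]]; exists V => //; rewrite VT.
Qed.

(** * Damped evolutions and their energy estimates *)

Lemma rdot_hermZ (R : realType) n (M : 'M[R[i]]_n) (w : R[i]) v : is_hermitian M ->
  rdot v (w *: (M *m v)) = complex.Re w * rdot v (M *m v).
Proof.
move=> hM; rewrite [in LHS](complexE w) scalerDl rdotDr rdotZr ['i * _]mulrC -scalerA rdotZr.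
by rewrite rdot_herm_i// mulr0 addr0.
Qed.

(** One family for all generators in use: [w = 1] is the target [A], [w = 'i * k] is the unitary
    evolution with parameter [k], and [w = D (1 - z)] is the sampled evolution. *)
Definition damped {R : realType} {n} (H L : R -> 'M[R[i]]_n) (w : R[i]) : R -> 'M[R[i]]_n :=
  fun t => 'i *: H t + w *: L t.

Lemma rdot_damped (R : realType) n (H L : R -> 'M[R[i]]_n) (w : R[i]) (t : R) v :
  is_hermitian (H t) -> is_hermitian (L t) ->
  rdot v (damped H L w t *m v) = complex.Re w * rdot v (L t *m v).
Proof.
move=> hH hL; rewrite /damped mulmxDl rdotDr -!scalemxAl rdot_herm_i// add0r.
exact: rdot_hermZ.
Qed.

(** The energy decreases at the rate [2 Re w] times the form of [L]. *)
Lemma damped_contraction (R : realType) n (T : R) (H L : R -> 'M[R[i]]_n) (w : R[i])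
    (psi : R -> 'cV[R[i]]_n) : 0 <= complex.Re w ->
  (forall t : R, 0 <= t <= T -> is_hermitian (H t) /\ is_hermitian (L t) /\ psd (L t)) ->
  vderiv T psi (fun t => - (damped H L w t *m psi t)) ->
  forall t : R, 0 <= t <= T -> vnorm (psi t) <= vnorm (psi 0).
Proof.
move=> w0 hHL hpsi t tT; have [c d] := vderiv_rdot _ _ _ _ _ hpsi.
rewrite vnorm_le ?vnorm_ge0// sqr_vnorm.
apply: (ler_of_derive _ T (fun s => rdot (psi s) (psi s)) (fun=> rdot (psi 0) (psi 0))
  _ (fun=> 0) c (within_continuous_cst _ _ _) d) => //.
move=> s /andP[/ltW s0 /ltW sT]; have [|hH [hL pL]] := hHL s; first by rewrite s0 sT.
by rewrite rdotNr rdot_damped// mulrN oppr_le0 !mulr_ge0// psd_rdot.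
Qed.

(** The difference solves the equation for [w1] with source [- a L psi2]. The damping term is
    dropped and [psd_cauchy] splits the source term; 5 is [2^2 + 1^2], from the bounds [2 |v|] on
    the difference and [|v|] on [psi2]. *)
Lemma damped_close (R : realType) n (T : R) (H L : R -> 'M[R[i]]_n) (w1 w2 : R[i]) (a Lam : R)
    (psi1 psi2 : R -> 'cV[R[i]]_n) : 0 <= T ->
  0 <= complex.Re w1 -> 0 <= complex.Re w2 -> 0 <= a -> w1 - w2 = a%:C ->
  (forall t : R, 0 <= t <= T -> is_hermitian (H t) /\ is_hermitian (L t) /\ psd (L t)) ->
  (forall t : R, 0 <= t <= T -> lambda_max (L t) <= Lam) ->
  vderiv T psi1 (fun t => - (damped H L w1 t *m psi1 t)) ->
  vderiv T psi2 (fun t => - (damped H L w2 t *m psi2 t)) ->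
  psi1 0 = psi2 0 ->
  rdot (psi1 T - psi2 T) (psi1 T - psi2 T) <= 5 * a * Lam * T * vnorm (psi1 0) ^+ 2.
Proof.
move=> T0 w1p w2p a0 wE hHL hLam h1 h2 h0.
have Lam0 : 0 <= Lam.
  have T00 : 0 <= (0 : R) <= T by rewrite lexx.
  have [hH [hL pL]] := hHL 0 T00.
  exact: le_trans (lambda_max_ge0 _ _ _ hL pL) (hLam 0 T00).
have [c d] := vderiv_rdot _ _ _ _ _ (vderivB _ _ _ _ _ _ _ h1 h2).
set v := psi1 0.
pose K := 5 * a * Lam * vnorm v ^+ 2.
suff : rdot (psi1 T - psi2 T) (psi1 T - psi2 T) <= K * T.
  by rewrite /K => /le_trans; apply; rewrite le_eqVlt; apply/orP; left; apply/eqP; ring.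
have dK (t : R) : 0 < t < T -> is_derive t 1 (fun s : R => K * s) K.
  by move=> _; rewrite -[X in is_derive _ _ _ X]mulr1; apply: is_deriveMc; exact: is_derive_id.
apply: (ler_of_derive _ T (fun s => rdot (psi1 s - psi2 s) (psi1 s - psi2 s)) (fun s => K * s)
  _ (fun=> K) c _ d dK); last by rewrite T0 lexx.
- by apply: within_continuous_scale; apply: continuous_subspaceT => x; exact: cvg_id.
- move=> t /andP[/ltW t0 /ltW tT].
  have tT' : 0 <= t <= T by rewrite t0 tT.
  have [hH [hL pL]] := hHL t tT'.
  set D := psi1 t - psi2 t.
  have -> : - (damped H L w1 t *m psi1 t) - - (damped H L w2 t *m psi2 t) =
      - (damped H L w1 t *m D) - a%:C *: (L t *m psi2 t).
    rewrite -wE /D /damped !mulmxDl !mulmxBr -!scalemxAl !scalerBl.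
    move: ('i *: (H t *m psi1 t)) ('i *: (H t *m psi2 t)) (w1 *: (L t *m psi1 t))
      (w1 *: (L t *m psi2 t)) (w2 *: (L t *m psi2 t)) => x1 x2 x3 x4 x5.
    by apply/matrixP => i j; rewrite !mxE; ring.
  rewrite rdotDr !rdotNr rdot_damped// rdotZr.
  have hD : rdot D D <= 4 * vnorm v ^+ 2.
    rewrite -sqr_vnorm (_ : 4 * _ = (2 * vnorm v) ^+ 2); last by ring.
    rewrite ler_sqr ?nnegrE ?vnorm_ge0 ?mulr_ge0 ?vnorm_ge0//.
    apply: le_trans (vnormB _ _ _ _) _.
    have n1 := damped_contraction _ _ _ _ _ _ _ w1p hHL h1 t tT'.
    have n2 := damped_contraction _ _ _ _ _ _ _ w2p hHL h2 t tT'.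
    by rewrite -h0 in n2; apply: le_trans (lerD n1 n2) _; rewrite -/v; lra.
  have h2n : rdot (psi2 t) (psi2 t) <= vnorm v ^+ 2.
    rewrite -sqr_vnorm ler_sqr ?nnegrE ?vnorm_ge0//.
    by rewrite /v h0; exact: (damped_contraction _ _ _ _ _ _ _ w2p hHL h2 t tT').
  have qD := psd_rdot _ _ _ D pL.
  have cs := psd_cauchy _ _ _ (- D) (psi2 t) hL pL.
  rewrite mulmxN !rdotNl rdotNr opprK in cs.
  have l1 := rdot_le_lambda_max _ _ _ D hL.
  have l2 := rdot_le_lambda_max _ _ _ (psi2 t) hL.
  have lb := hLam t tT'.
  have l1' : rdot D (L t *m D) <= Lam * (4 * vnorm v ^+ 2).
    by apply: le_trans l1 _; apply: ler_pM => //; [exact: lambda_max_ge0|exact: rdot_ge0].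
  have l2' : rdot (psi2 t) (L t *m psi2 t) <= Lam * vnorm v ^+ 2.
    by apply: le_trans l2 _; apply: ler_pM => //; [exact: lambda_max_ge0|exact: rdot_ge0].
  have e1 : 0 <= complex.Re w1 * rdot D (L t *m D) by rewrite mulr_ge0.
  have e2 : a * (2 * - rdot D (L t *m psi2 t)) <= a * (Lam * (4 * vnorm v ^+ 2) + Lam * vnorm v ^+ 2).
    by rewrite ler_wpM2l//; apply: le_trans cs _; exact: lerD.
  rewrite /K.
  have -> : 5 * a * Lam * vnorm v ^+ 2 = a * (Lam * (4 * vnorm v ^+ 2) + Lam * vnorm v ^+ 2) by ring.
  apply: le_trans e2; move: e1; clear.
  move: (complex.Re w1 * _) => p; move: (rdot D _) => x; lra.
- by rewrite h0 subrr /rdot mulmx0 mxE mulr0.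
Qed.

(** Summation by parts: shifting the index doubles the weight, so the sum itself reappears once,
    with a boundary term at [M.+1] and [- 2 q 0], which is dropped. *)
Lemma dyadic_telescope (R : realFieldType) (q : nat -> R) (M : nat) : 0 <= q 0%N ->
  \sum_(m < M.+1) 2^-1 ^+ m * (q m.+1 - q m) <=
  \sum_(m < M.+1) 2^-1 ^+ m * q m + 2^-1 ^+ M * q M.+1.
Proof.
move=> q0.
suff -> : \sum_(m < M.+1) 2^-1 ^+ m * (q m.+1 - q m) =
    \sum_(m < M.+1) 2^-1 ^+ m * q m + 2^-1 ^+ M * q M.+1 - 2 * q 0%N by lra.
elim: M => [|M IH]; first by rewrite !big_ord_recl !big_ord0 expr0; ring.
by rewrite !(big_ord_recr M.+1) /= IH exprS; field.
Qed.

(** The Hamiltonian part drops out by skewness and [psd_cauchy] bounds the cross term, leaving a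
    flux from level [v] to level [u]. *)
Lemma upwind_dissipation (R : realType) n (D : R) (M K : 'M[R[i]]_n) (u v : 'cV[R[i]]_n) :
  0 <= D -> is_hermitian M -> is_hermitian K -> psd K ->
  2 * rdot u (- ('i *: (M *m u)) - D%:C *: (K *m (u - v))) <=
  D * (rdot v (K *m v) - rdot u (K *m u)).
Proof.
move=> D0 hM hK pK; rewrite (mulmxBr K u v).
move: (rdot_herm_i R n M u hM) (psd_cauchy R n K u v hK pK).
move: ('i *: (M *m u)) (K *m u) (K *m v) => p a b hp hab.
rewrite rdotDr !rdotNr rdotZr rdotDr rdotNr hp.
have := ler_wpM2l D0 hab; lra.
Qed.

(* The weights [2 ^- m] make the flux telescope up to the term of index [M.+1], for
   which only the a priori bound [C2] is available. *)
Lemma upwind_energy (R : realType) n (T D C2 : R) (M : nat) (H L : R -> 'M[R[i]]_n)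
    (psi : nat -> R -> 'cV[R[i]]_n) : 0 < T -> 0 <= D -> 0 <= C2 -> mx_cont_on T L ->
  (forall t : R, 0 <= t <= T -> is_hermitian (H t) /\ is_hermitian (L t) /\ psd (L t)) ->
  (forall m, vderiv T (psi m) (fun t =>
     - ('i *: (H t *m psi m t)) - D%:C *: (L t *m (psi m t - psi m.+1 t)))) ->
  (forall m (t : R), 0 <= t <= T -> rdot (psi m t) (psi m t) <= C2) ->
  (forall m, (m <= M)%N -> psi m 0 = 0) ->
  rdot (psi 0%N T) (psi 0%N T) <=
    expR (D * Rintegral lebesgue_measure `[0, T] (fun t => lambda_max (L t))) * (2^-1 ^+ M * C2).
Proof.
move=> T0 D0 C0 cL hHL hpsi bpsi psi0.
have cl : {within `[0, T], continuous (fun t => lambda_max (L t))}.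
  by apply: continuous_lambda_max => // t tT; have [_ []] := hHL t tT.
have p0 m : 0 <= 2^-1 ^+ m :> R by rewrite exprn_ge0// invr_ge0.
pose e m t := rdot (psi m t) (psi m t).
pose de m t := 2 * rdot (psi m t)
  (- ('i *: (H t *m psi m t)) - D%:C *: (L t *m (psi m t - psi m.+1 t))).
have eP m := vderiv_rdot _ _ _ _ _ (hpsi m).
(* The added constant dominates the boundary flux, which closes the inequality
   [f' <= D lambda_max f]. *)
pose f (t : R) := \sum_(m < M.+1) 2^-1 ^+ m * e m t + 2^-1 ^+ M * C2.
have := @gronwall R T f (fun t => \sum_(m < M.+1) 2^-1 ^+ m * de m t) (fun t => D * lambda_max (L t)) T0.
have -> : f 0 = 2^-1 ^+ M * C2.
  rewrite /f big1 ?add0r// => m _; rewrite /e psi0 ?(leq_ord m)//.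
  by rewrite /rdot mulmx0 mxE mulr0.
have -> : Rintegral lebesgue_measure `[0, T] (fun t => D * lambda_max (L t)) =
    D * Rintegral lebesgue_measure `[0, T] (fun t => lambda_max (L t)).
  apply: RintegralZl => //.
  by apply: continuous_compact_integrable => //; exact: segment_compact.
move=> hG; apply: le_trans (hG _ _ _ _).
- rewrite /f big_ord_recl expr0 mul1r -addrA lerDl addr_ge0 ?mulr_ge0//.
  by apply: sumr_ge0 => m _; rewrite mulr_ge0// rdot_ge0.
- apply: within_continuous_add; last exact: within_continuous_cst.
  by apply: within_continuous_sum => m; apply: within_continuous_scale; have [] := eP m.
- exact: within_continuous_scale.
- move=> t tT; rewrite -[X in is_derive _ _ _ X]addr0; apply: is_deriveD.
  by apply: is_derive_bigsum => m; apply: is_deriveMc; have [_ ] := eP m; exact.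
move=> t /andP[/ltW t0 /ltW tT].
have tT' : 0 <= t <= T by rewrite t0 tT.
have [hH [hL pL]] := hHL t tT'.
pose q m := rdot (psi m t) (L t *m psi m t).
have q0 m : 0 <= q m by exact: psd_rdot.
have lam0 := lambda_max_ge0 _ _ _ hL pL.
have deq m : de m t <= D * (q m.+1 - q m) by exact: upwind_dissipation.
have s1 : \sum_(m < M.+1) 2^-1 ^+ m * de m t <= D * \sum_(m < M.+1) 2^-1 ^+ m * (q m.+1 - q m).
  rewrite mulr_sumr; apply: ler_sum => m _; rewrite [leRHS]mulrCA.
  by rewrite ler_wpM2l.
apply: le_trans s1 _; rewrite -mulrA ler_wpM2l//.
apply: le_trans (dyadic_telescope _ _ _ (q0 0%N)) _.
rewrite /f mulrDr lerD//.
  rewrite mulr_sumr; apply: ler_sum => m _; rewrite mulrCA ler_wpM2l//.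
  exact: rdot_le_lambda_max.
rewrite mulrCA ler_wpM2l//; apply: le_trans (rdot_le_lambda_max _ _ _ _ hL) _.
by rewrite ler_wpM2l// bpsi.
Qed.

(** * Sampling nodes and weights *)

Definition cis {R : realType} (x : R) : R[i] := cos x +i* sin x.

Lemma cisD (R : realType) (x y : R) : cis (x + y) = cis x * cis y.
Proof. by rewrite /cis cosD sinD /=; simpc; congr (_ +i* _); rewrite addrC. Qed.

Lemma cis0 (R : realType) : cis (0 : R) = 1.
Proof. by rewrite /cis cos0 sin0. Qed.

Lemma cisX (R : realType) (x : R) n : cis x ^+ n = cis (n%:R * x).
Proof.
elim: n => [|n IH]; first by rewrite mul0r cis0.
by rewrite exprS IH -cisD -natr1 mulrDl mul1r addrC.
Qed.

Lemma cabs_cis (R : realType) (x : R) : cabs (cis x) = 1.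
Proof. by rewrite /cabs /cabs2 /= cos2Dsin2 sqrtr1. Qed.

Lemma cis_conj (R : realType) (x : R) : cis x * conjc (cis x) = 1.
Proof.
by rewrite (_ : conjc _ = cis (- x)) -?cisD ?subrr ?cis0// /cis cosN sinN.
Qed.

Lemma cis2pi (R : realType) : cis (2 * pi : R) = 1.
Proof. by rewrite /cis mulr_natl cos2pi sin2pi. Qed.

Lemma cos_half (R : realType) (x : R) : cos x = 1 - 2 * sin (x / 2) ^+ 2.
Proof.
have {1}-> : x = (x / 2) *+ 2 by rewrite -mulr_natr mulfVK.
by rewrite cos_mulr2n cos2sin2; ring.
Qed.

Lemma cis_neq1 (R : realType) (x : R) : 0 < x < 2 * pi -> cis x != 1.
Proof.
move=> /andP[x0 xpi]; apply/eqP => -[+ _]; rewrite cos_half => h.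
have : 0 < sin (x / 2) by apply: sin_gt0_pi; rewrite divr_gt0//= ltr_pdivrMr// mulrC.
move=> sp; have : 0 < sin (x / 2) ^+ 2 by rewrite exprn_gt0.
by move: h; set u := _ ^+ 2; lra.
Qed.

Lemma abs_sin_le (R : realType) (x : R) : `|sin x| <= `|x|.
Proof.
wlog x0 : x / 0 <= x => [hw|].
  by have [/hw//|/ltW x0] := leP 0 x; rewrite -normrN -sinN -[leRHS]normrN; apply: hw; rewrite oppr_ge0.
rewrite (ger0_norm x0).
have cs : {within `[0, x], continuous (@sin R)}.
  by apply: continuous_subspaceT => y; exact: continuous_sin.
have ci (c : R) : {within `[0, x], continuous (fun t : R => c * t)}.
  by apply: within_continuous_scale; apply: continuous_subspaceT => y; exact: cvg_id.
have di (c t : R) : is_derive t 1 (fun t : R => c * t) c.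
  by rewrite -[X in is_derive _ _ _ X]mulr1; apply: is_deriveZ; exact: is_derive_id.
have xx : 0 <= x <= x by rewrite x0 lexx.
rewrite ler_norml; apply/andP; split.
  rewrite -mulN1r.
  apply: (ler_of_derive _ x _ _ _ _ (ci (-1)) cs (fun t _ => di _ t) (fun t _ => is_derive_sin t)) => //.
    by move=> t _; exact: cos_geN1.
  by rewrite mulr0 sin0.
rewrite -[leRHS]mul1r.
apply: (ler_of_derive _ x _ _ _ _ cs (ci 1) (fun t _ => is_derive_sin t) (fun t _ => di _ t)) => //.
by rewrite mulr0 sin0.
Qed.

Lemma onem_cos_le (R : realType) (x : R) : 1 - cos x <= x ^+ 2 / 2.
Proof.
rewrite cos_half; have := abs_sin_le R (x / 2).
rewrite -ler_sqr ?nnegrE// !real_normK ?num_real//.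
set u := sin _ ^+ 2; rewrite expr_div_n; lra.
Qed.

Lemma mul_cos_le_sin (R : realType) (x : R) : 0 <= x <= pi / 2 -> x * cos x <= sin x.
Proof.
move=> /andP[x0 xp].
have xx : 0 <= x <= x by rewrite x0 lexx.
have c1 : {within `[0, x], continuous (fun t : R => t * cos t)}.
  apply: within_continuous_mul.
    by apply: continuous_subspaceT => y; exact: cvg_id.
  by apply: continuous_subspaceT => y; exact: continuous_cos.
have c2 : {within `[0, x], continuous (@sin R)}.
  by apply: continuous_subspaceT => y; exact: continuous_sin.
have d1 (t : R) : is_derive t 1 (fun t : R => t * cos t) (cos t - t * sin t).
  have h1 := is_derive_id t (1 : R); have h2 := is_derive_cos t.
  rewrite (_ : cos t - _ = t *: (- sin t) + cos t *: 1); first exact: is_deriveM.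
  by rewrite /GRing.scale /=; ring.
apply: (ler_of_derive _ x _ _ _ _ c1 c2 (fun t _ => d1 t) (fun t _ => is_derive_sin t)) => //.
  move=> t /andP[t0 tx]; rewrite gerBl mulr_ge0 ?(ltW t0)// sin_ge0_pi// (ltW t0)/=.
  apply: le_trans (ltW tx) _; apply: le_trans xp _.
  by rewrite ler_pdivrMr// ler_peMr ?pi_ge0// ler1n.
by rewrite mul0r sin0.
Qed.

(** With [t = x / 2] and [u = sin t ^ 2], squaring [t cos t <= sin t] gives [t^2 <= u (1 + t^2)],
    and [1 + t^2 <= pi^2 / 2] on this range. The constant is not sharp; what counts is quadratic
    growth all the way to [pi]. *)
Lemma onem_cos_ge (R : realType) (x : R) : `|x| <= pi -> x ^+ 2 / (4 * pi ^+ 2) <= 1 - cos x.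
Proof.
wlog x0 : x / 0 <= x => [hw|].
  have [/hw//|/ltW x0] := leP 0 x.
  by rewrite -normrN -sqrrN -cosN; apply: hw; rewrite oppr_ge0.
rewrite (ger0_norm x0) => xp; rewrite cos_half.
set t := x / 2; have -> : x = 2 * t by rewrite /t mulrC mulfVK.
have t0 : 0 <= t by rewrite /t divr_ge0.
have tp : t <= pi / 2 by rewrite ler_pM2r.
have hs : t * cos t <= sin t by apply: mul_cos_le_sin; rewrite t0.
have c0 : 0 <= cos t.
  by apply: cos_ge0_pihalf; rewrite tp andbT (le_trans _ t0)// oppr_le0 divr_ge0// pi_ge0.
have : (t * cos t) ^+ 2 <= sin t ^+ 2.
  by rewrite ler_sqr ?nnegrE ?mulr_ge0// (le_trans _ hs)// mulr_ge0.
rewrite exprMn cos2sin2; set u := sin t ^+ 2 => hu.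
have u0 : 0 <= u by exact: sqr_ge0.
have pi2 : 4 <= pi ^+ 2 :> R.
  rewrite (_ : 4 = 2 ^+ 2); last by rewrite -natrX.
  by rewrite ler_sqr ?nnegrE ?pi_ge0// pi_ge2.
have t2 : 4 * t ^+ 2 <= pi ^+ 2.
  rewrite (_ : 4 * _ = (2 * t) ^+ 2); last by ring.
  by rewrite ler_sqr ?nnegrE ?pi_ge0 ?mulr_ge0//; move: tp; lra.
rewrite opprB addrC subrK ler_pdivrMr ?mulr_gt0 ?exprn_gt0 ?pi_gt0//.
rewrite (_ : (2 * t) ^+ 2 = 4 * t ^+ 2); last by ring.
move: (t ^+ 2) (pi ^+ 2) hu pi2 t2 => y z hu hz hy.
have h1 : y <= u + u * y by lra.
have h2 : u * (4 * y) <= u * z by rewrite ler_wpM2l.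
have h3 : u * 4 <= u * z by rewrite ler_wpM2l.
lra.
Qed.

(** The increment of [F x = x / (P + |x|)] over a unit step is at least a quarter of the summand,
    and [F] takes values in [-1, 1]. The sum thus telescopes to a bound free of [P] and [c]. *)
Lemma lorentz_sum (R : realType) (P : R) (c : nat) : 1 <= P ->
  \sum_(i < c.*2) P / (P ^+ 2 + (i%:R - c%:R) ^+ 2) <= 8.
Proof.
move=> P1; have P0 : 0 < P by exact: lt_le_trans P1.
pose F (x : R) := x / (P + `|x|).
have step (i : nat) : P / (P ^+ 2 + (i%:R - c%:R) ^+ 2) <=
    4 * (F (i.+1%:R - c%:R) - F (i%:R - c%:R)).
  have -> : i.+1%:R - c%:R = i%:R - c%:R + 1 :> R by rewrite -[i.+1%:R]natr1 addrAC.
  rewrite /F; have [ci|ic] := leqP c i.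
    have : 0 <= i%:R - c%:R :> R by rewrite subr_ge0 ler_nat.
    set x := _ - _ => x0; rewrite !ger0_norm; [|lra|lra].
    rewrite (_ : _ - _ = P / ((P + x) * (P + (x + 1)))); last by field; rewrite !gt_eqF//; lra.
    rewrite mulrA ler_pdivrMr; last by rewrite ltr_pwDl ?exprn_gt0 ?sqr_ge0.
    rewrite mulrAC ler_pdivlMr; last by rewrite mulr_gt0; lra.
    rewrite [4 * P]mulrC -!mulrA ler_pM2l//.
    have h1 : 0 <= (P - 1) * x by rewrite mulr_ge0// subr_ge0.
    have h2 : 0 <= (P - 1) * P by rewrite mulr_ge0 ?subr_ge0// ltW.
    have h3 := sqr_ge0 (P - x).
    have h4 := sqr_ge0 P; have h5 := sqr_ge0 x; lra.
  have : i%:R - c%:R <= - 1 :> R by rewrite lerBlDr addrC lerBrDr natr1 ler_nat.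
  set x := _ - _ => x0; rewrite !ler0_norm; [|lra|lra].
  rewrite (_ : _ - _ = P / ((P - x) * (P - (x + 1)))); last by field; rewrite !gt_eqF//; lra.
  rewrite mulrA ler_pdivrMr; last by rewrite ltr_pwDl ?exprn_gt0 ?sqr_ge0.
  rewrite mulrAC ler_pdivlMr; last by rewrite mulr_gt0; lra.
  rewrite [4 * P]mulrC -!mulrA ler_pM2l//.
  have h3 := sqr_ge0 (P + x).
  have h4 := sqr_ge0 P; have h5 := sqr_ge0 x; lra.
have F1 (x : R) : `|F x| <= 1.
  have Px : 0 < P + `|x| by rewrite ltr_pwDl.
  by rewrite /F normrM normfV (gtr0_norm Px) ler_pdivrMr// mul1r lerDr ltW.
apply: (@le_trans _ _ (\sum_(0 <= i < c.*2) 4 * (F (i.+1%:R - c%:R) - F (i%:R - c%:R)))).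
  by rewrite big_mkord; apply: ler_sum => i _; exact: step.
rewrite -mulr_sumr (telescope_sumr (fun i => F (i%:R - c%:R)))//.
have := F1 (c.*2%:R - c%:R); have := F1 (0%:R - c%:R); rewrite !ler_norml; lra.
Qed.

(** The roots of unity of order [c.*2], numbered from -1 so that index [c] is the point 1 and
    [i - c] is the centred index. *)
Definition node (R : realType) (c i : nat) : R[i] :=
  cis (- pi) * cis (2 * pi / c.*2%:R) ^+ i.

Lemma nodeE (R : realType) (c i : nat) : (0 < c)%N ->
  node R c i = cis (pi * ((i%:R - c%:R) / c%:R)).
Proof.
move=> c0; rewrite /node cisX -cisD; congr (cis _).
rewrite -mul2n natrM; field.
by rewrite pnatr_eq0 -lt0n c0.
Qed.

Lemma cabs_node (R : realType) (c i : nat) : cabs (node R c i) = 1.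
Proof. by rewrite /node cabsM cabsX !cabs_cis expr1n mul1r. Qed.

Lemma node_conj (R : realType) (c i : nat) : node R c i * conjc (node R c i) = 1.
Proof.
by rewrite /node rmorphM rmorphXn /= mulrACA cis_conj mul1r -exprMn cis_conj expr1n.
Qed.

Lemma sum_nodeX (R : realType) (c m : nat) : (0 < m < c.*2)%N ->
  \sum_(i < c.*2) node R c i ^+ m = 0.
Proof.
move=> /andP[m0 mq]; have q0 : (0 < c.*2)%N by exact: leq_trans mq.
pose w : R[i] := cis (2 * pi / c.*2%:R).
rewrite (eq_bigr (fun i : 'I_c.*2 => cis (- pi) ^+ m * (w ^+ m) ^+ i)); last first.
  by move=> i _; rewrite /node exprMn -!exprM mulnC.
rewrite -mulr_sumr.
have w1 : w ^+ m != 1.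
  rewrite /w cisX; apply: cis_neq1.
  have qp : 0 < c.*2%:R :> R by rewrite ltr0n.
  rewrite mulr_gt0 ?divr_gt0 ?mulr_gt0 ?pi_gt0 ?ltr0n//=.
  rewrite mulrA ltr_pdivrMr// mulrC ltr_pM2l ?mulr_gt0 ?pi_gt0//.
  by rewrite ltr_nat.
suff : (w ^+ m - 1) * \sum_(i < c.*2) (w ^+ m) ^+ i = 0.
  move/eqP; rewrite mulf_eq0 subr_eq0 (negPf w1) /= => /eqP ->.
  by rewrite mulr0.
rewrite -subrX1 -exprM mulnC exprM /w cisX mulrC divfK ?cis2pi ?expr1n ?subrr//.
by rewrite pnatr_eq0 -lt0n.
Qed.

(** As conjugation inverts a node, each summand is the power [a - p] of a node, or for [p > a] the
    conjugate of the power [p - a]. *)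
Lemma sum_node_conj (R : realType) (c a p : nat) : (a < c.*2)%N -> (p < c.*2)%N ->
  \sum_(i < c.*2) node R c i ^+ a * conjc (node R c i) ^+ p = (a == p)%:R * c.*2%:R.
Proof.
move=> ha hp; have [<-|ap] := eqVneq a p.
  rewrite (eq_bigr (fun=> 1)); last by move=> i _; rewrite -exprMn node_conj expr1n.
  by rewrite sumr_const card_ord mul1r.
rewrite mul0r; have [le_pa|lt_ap] := leqP p a.
  have := sum_nodeX R c (a - p).
  rewrite subn_gt0 ltn_neqAle eq_sym ap le_pa (leq_ltn_trans (leq_subr _ _))//= => /(_ isT) h.
  rewrite -[RHS]h.
  apply: eq_bigr => i _; rewrite -{1}(subnK le_pa) exprD -mulrA -exprMn.
  by rewrite node_conj expr1n mulr1.
have := sum_nodeX R c (p - a).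
rewrite subn_gt0 lt_ap (leq_ltn_trans (leq_subr _ _)) // => /(_ isT) /(congr1 (@conjc R)).
rewrite rmorph_sum conjc0 => h; rewrite -[RHS]h.
apply: eq_bigr => i _; rewrite rmorphXn /= -{1}(subnK (ltnW lt_ap)) exprD mulrCA -exprMn.
by rewrite node_conj expr1n mulr1.
Qed.

(* The first two factors form the discrete Fourier coefficient of [s ^+ m],
   [0 <= m < c.*2]; the term ['X^l] of [p] shifts that sequence by [l] and rescales it
   by [s ^- l], which is invisible as long as [m + l] does not wrap around. *)
Definition weight {R : realType} (c : nat) (s : R) (p : {poly R[i]}) (i : nat) : R[i] :=
  (c.*2%:R)^-1 * (\sum_(k < c.*2) (s%:C * conjc (node R c i)) ^+ k) * p.[node R c i / s%:C].

(** Since [l + m < c.*2], orthogonality selects [k = l + m] in the contribution of ['X^l]. What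
    remains is [s^(l+m) s^-l = s^m], and the coefficients of [p] add up to [p.[1]]. *)
Lemma weight_interpolation (R : realType) (c m : nat) (s : R) (p : {poly R[i]}) :
  s != 0 -> (0 < c)%N -> (size p + m <= c.*2)%N ->
  \sum_(i < c.*2) weight c s p i * node R c i ^+ m = s%:C ^+ m * p.[1].
Proof.
move=> s0 c0 hp.
have sC0 : s%:C != 0 :> R[i] by rewrite fmorph_eq0.
have q0 : c.*2%:R != 0 :> R[i] by rewrite pnatr_eq0 double_eq0 -lt0n.
have := sum_node_conj R c; rewrite /weight; move: (node R c) => z ortho.
transitivity (\sum_(l < size p) p`_l * s%:C^-1 ^+ l * \sum_(k < c.*2) s%:C ^+ k *
    ((c.*2%:R)^-1 * \sum_(i < c.*2) z i ^+ (l + m) * conjc (z i) ^+ k)).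
  under eq_bigr do rewrite horner_coef -!mulrA mulr_suml.
  rewrite -mulr_sumr exchange_big /=.
  under [in RHS]eq_bigr do (under eq_bigr do rewrite mulrCA).
  under [in RHS]eq_bigr do rewrite -mulr_sumr mulrCA.
  rewrite -mulr_sumr; congr (_ * _).
  under [in RHS]eq_bigr do (rewrite mulr_sumr; under eq_bigr do rewrite mulr_sumr mulr_sumr).
  rewrite [RHS]exchange_big /=; apply: eq_bigr => k _.
  rewrite [RHS]exchange_big /=; apply: eq_bigr => i _.
  rewrite mulr_suml mulr_sumr; apply: eq_bigr => l _.
  by rewrite !exprMn exprD; ring.
have hl (l : 'I_(size p)) : (l + m < c.*2)%N.
  by apply: leq_trans hp; rewrite ltn_add2r.
transitivity (\sum_(l < size p) p`_l * s%:C ^+ m).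
  apply: eq_bigr => l _; rewrite -mulrA; congr (_ * _).
  rewrite (bigD1 (Ordinal (hl l)))//= [X in _ + X]big1 => [|k kl].
    rewrite ortho// eqxx mul1r mulVf// mulr1 addr0 exprD mulrA -exprMn mulVf//.
    by rewrite expr1n mul1r.
  rewrite ortho//; case: eqP => [e|]; last by rewrite mul0r !mulr0.
  by case/eqP: kl; apply: val_inj.
rewrite -mulr_suml mulrC horner_coef; congr (_ * _).
by apply: eq_bigr => l _; rewrite expr1n mulr1.
Qed.

(** * Moving averages *)

Definition average (R : realType) (d : nat) : {poly R[i]} :=
  (d%:R)^-1 *: \sum_(l < d) 'X^l.

Lemma size_average (R : realType) d : (size (average R d) <= d)%N.
Proof.
apply: leq_trans (size_scale_leq _ _) _; apply: leq_trans (size_sum _ _ _) _.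
by apply/bigmax_leqP => l _; rewrite size_polyXn.
Qed.

Lemma average_eval (R : realType) d (y : R[i]) :
  (average R d).[y] = (d%:R)^-1 * \sum_(l < d) y ^+ l.
Proof. by rewrite hornerZ horner_sum; under eq_bigr do rewrite hornerXn. Qed.

Lemma average1 (R : realType) d : (0 < d)%N -> (average R d).[1] = 1.
Proof.
move=> d0; rewrite average_eval (eq_bigr (fun=> 1)); last by move=> l _; rewrite expr1n.
by rewrite sumr_const card_ord mulVf// pnatr_eq0 -lt0n.
Qed.

Lemma cabs_nat (R : realType) (d : nat) : cabs (d%:R : R[i]) = d%:R.
Proof. by rewrite -(rmorph_nat (real_complex R)) cabs_real ger0_norm. Qed.

Lemma cabs_average_le (R : realType) d (y : R[i]) (r : R) : (0 < d)%N -> 1 <= r ->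
  cabs y <= r -> cabs (average R d).[y] <= r ^+ d.
Proof.
move=> d0 r1 yr; rewrite average_eval cabsM cabsV cabs_nat.
rewrite ler_pdivrMl ?ltr0n//; apply: le_trans (cabs_sum _ _ _ _ _) _.
rewrite mulr_natl -[X in _ *+ X]card_ord -sumr_const; apply: ler_sum => l _.
rewrite cabsX; apply: (@le_trans _ _ (r ^+ l)).
  by rewrite lerXn2r ?nnegrE ?cabs_ge0// (le_trans ler01 r1).
by rewrite ler_weXn2l// ltnW.
Qed.

(** The geometric sum times [y - 1] is [y^d - 1]: averaging gains a factor of order
    [1 / (d |y - 1|)]. *)
Lemma cabs_average_decay (R : realType) d (y : R[i]) (r : R) : (0 < d)%N ->
  cabs y <= r -> d%:R * cabs (y - 1) * cabs (average R d).[y] <= r ^+ d + 1.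
Proof.
move=> d0 yr; rewrite average_eval cabsM cabsV cabs_nat mulrACA divff ?pnatr_eq0 -?lt0n// mul1r.
rewrite -cabsM -subrX1; apply: le_trans (cabsD _ _ _) _; rewrite cabsN cabs1 lerD2r cabsX.
by rewrite lerXn2r ?nnegrE ?cabs_ge0// (le_trans (cabs_ge0 _ _) yr).
Qed.

Lemma bernoulli_ineq (R : realFieldType) (x : R) n : 0 <= x <= 1 -> 1 - n%:R * x <= (1 - x) ^+ n.
Proof.
move=> /andP[x0 x1]; elim: n => [|n IH]; first by rewrite mul0r subr0.
rewrite exprS; apply: (@le_trans _ _ ((1 - x) * (1 - n%:R * x))); last by rewrite ler_wpM2l ?subr_ge0.
rewrite -natr1; have : 0 <= n%:R * (x * x) by rewrite !mulr_ge0.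
lra.
Qed.

(** [D] is even so that Bernoulli's inequality can be applied at half the exponent, where it gives
    [s^k >= 1/2]; squaring yields 4. *)
Lemma exprn_inv_onem (R : realType) (D k : nat) : (0 < k)%N -> D = k.*2 ->
  (1 - D%:R^-1)^-1 ^+ D <= 4 :> R.
Proof.
move=> k0 ->; have q0 : 0 < k%:R :> R by rewrite ltr0n.
have -> : k.*2%:R = 2 * k%:R :> R by rewrite -mul2n natrM.
have k1 : 1 <= k%:R :> R by rewrite ler1n.
have i1 : 0 <= (2 * k%:R : R)^-1 <= 1.
  by rewrite invr_ge0 mulr_ge0//= invf_le1 ?mulr_gt0//; lra.
have := bernoulli_ineq _ _ k i1.
rewrite (_ : _ - _ * _ = 2^-1); last by field; rewrite gt_eqF.
set s := 1 - _ => h.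
have sk : 0 < s ^+ k by apply: lt_le_trans h; rewrite invr_gt0.
have s2 : 4^-1 <= s ^+ k.*2.
  rewrite -addnn exprD (_ : 4^-1 = 2^-1 * 2^-1); last by field.
  by apply: ler_pM => //; rewrite invr_ge0.
rewrite exprVn -[leRHS]invrK lef_pV2// posrE ?invr_gt0//.
by apply: lt_le_trans s2; rewrite invr_gt0.
Qed.

Lemma leq_two_mul_double n k : (0 < n)%N -> (0 < k)%N -> (2 <= n * k.*2)%N.
Proof. by move=> n0 k0; rewrite -mul2n; nia. Qed.

(* One average over [n * k.*2] terms makes the weights summable; the [n] short
   averages make them exponentially small in [n] at high frequency. *)
Definition dampfilter (R : realType) (n k : nat) : {poly R[i]} :=
  average R (n * k.*2) * average R k.*2 ^+ n.

(** * Exactness, summability and decay of the weights *)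

Section Bounds.
Variables (R : realType) (n k P : nat).
Hypotheses (n0 : (0 < n)%N) (k0 : (0 < k)%N) (P0 : (0 < P)%N).
Let d := k.*2.
Let D := (n * d)%N.
Let c := (P * n * k)%N.
Let s : R := 1 - D%:R^-1.
Let filter := dampfilter R n k.

Lemma double_grid : c.*2 = (P * D)%N.
Proof. by rewrite /c /D /d -!mul2n; ring. Qed.

Lemma filter_size_ge2 : (2 <= D)%N.
Proof. exact: leq_two_mul_double. Qed.

Lemma grid_gt0 : (0 < c)%N. Proof. by rewrite /c !muln_gt0 n0 k0 P0. Qed.

Lemma damping_ge_half : 2^-1 <= s.
Proof.
rewrite /s lerBrDr -lerBrDl (_ : 1 - 2^-1 = 2^-1); last by field.
by rewrite lef_pV2 ?posrE ?ltr0n ?ler_nat ?filter_size_ge2// (leq_trans _ filter_size_ge2).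
Qed.

Lemma damping_gt0 : 0 < s. Proof. by apply: lt_le_trans damping_ge_half; rewrite invr_gt0. Qed.

Lemma size_filter : (size filter <= D.*2)%N.
Proof.
rewrite /filter /dampfilter -/d -/D.
apply: leq_trans (size_polyMleq _ _) _.
have h1 := size_average R D; have h2 := size_average R d.
have h3 := size_poly_exp_leq (average R d) n.
have h4 : ((size (average R d)).-1 * n < D.+1)%N.
  rewrite ltnS /D mulnC leq_mul2l; apply/orP; right.
  exact: leq_trans (leq_pred _) h2.
have := filter_size_ge2; lia.
Qed.

Lemma filter1 : filter.[1] = 1.
Proof.
rewrite /filter /dampfilter hornerM horner_exp !average1 ?expr1n ?mul1r//; last by rewrite (leq_trans _ filter_size_ge2).
by rewrite double_gt0.
Qed.

(** The filter has total mass 1 and size at most [2 D], while the grid has [P D] points: exponents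
    up to [(P - 2) D] do not wrap around. *)
Lemma weight_exact m : (m <= (P - 2) * D)%N -> (2 <= P)%N ->
  \sum_(i < c.*2) weight c s filter i * node R c i ^+ m = s%:C ^+ m.
Proof.
move=> hm P2; rewrite weight_interpolation ?filter1 ?mulr1// ?grid_gt0 ?gt_eqF ?damping_gt0//.
rewrite double_grid; have := size_filter; have := filter_size_ge2; nia.
Qed.

Let b (i : nat) : R := i%:R - c%:R.
Let tau i : R := cabs (node R c i - s%:C).

(** [tau^2 = (1 - s)^2 + 2 s (1 - cos phi)] with [1 - s = 1/D] and [2 s >= 1]; then [onem_cos_ge] at
    [phi = pi b / c], where [2 c = P D]. *)
Lemma node_dist_lower i : (i <= c.*2)%N ->
  (P%:R ^+ 2 + b i ^+ 2) / (P%:R * D%:R) ^+ 2 <= tau i ^+ 2.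
Proof.
move=> ic; have cp : 0 < c%:R :> R by rewrite ltr0n grid_gt0.
have Dp : 0 < D%:R :> R by rewrite ltr0n (leq_trans _ filter_size_ge2).
have Pp : 0 < P%:R :> R by rewrite ltr0n.
set phi := pi * (b i / c%:R).
have hphi : `|phi| <= pi.
  rewrite normrM (ger0_norm (pi_ge0 R)) ler_piMr ?pi_ge0// normrM normfV (gtr0_norm cp).
  rewrite ler_pdivrMr// mul1r ler_distl subrr ler0n/= -natrD addnn.
  by rewrite ler_nat.
have := onem_cos_ge R phi hphi.
rewrite (_ : phi ^+ 2 / _ = b i ^+ 2 / (P%:R * D%:R) ^+ 2); last first.
  rewrite -natrM -double_grid -mul2n natrM /phi.
  by move: pi (pi_gt0 R) => p pp; field; rewrite (gt_eqF cp) (gt_eqF pp).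
have -> : tau i ^+ 2 = (1 - s) ^+ 2 + 2 * s * (1 - cos phi).
  rewrite sqr_cabs nodeE ?grid_gt0// -/(b i) -/phi /cabs2 /cis /= subr0 sin2cos2; ring.
have -> : (P%:R ^+ 2 + b i ^+ 2) / (P%:R * D%:R) ^+ 2 =
    (1 - s) ^+ 2 + b i ^+ 2 / (P%:R * D%:R) ^+ 2.
  by rewrite /s; field; rewrite !gt_eqF.
have := damping_ge_half; have := cos_le1 phi; set u := _ / _ => h1 h2 h3.
rewrite lerD2l; apply: le_trans h3 _; rewrite ler_peMl ?subr_ge0//; lra.
Qed.

Lemma node_dist_gt0 i : 0 < tau i.
Proof.
have Dp : 0 < D%:R :> R by rewrite ltr0n (leq_trans _ filter_size_ge2).
have -> : tau i = cabs (s%:C - node R c i) by rewrite /tau -cabsN opprB.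
have := cabsD _ (node R c i - s%:C) s%:C; rewrite subrK cabs_node cabs_real.
rewrite gtr0_norm ?damping_gt0// -cabsN opprB.
move=> h; have : 0 < 1 - s by rewrite /s subKr invr_gt0.
by move: h; lra.
Qed.

Lemma cabs_scaled_node i : cabs (node R c i / s%:C) = s^-1.
Proof. by rewrite cabsM cabsV cabs_node mul1r cabs_real gtr0_norm// damping_gt0. Qed.

Lemma damping_inv_ge1 : 1 <= s^-1.
Proof. by rewrite invf_ge1 ?damping_gt0// /s gerBl invr_ge0 ler0n. Qed.

Lemma damping_expn : s^-1 ^+ D <= 4.
Proof.
by apply: (exprn_inv_onem R D (n * k)); rewrite ?muln_gt0 ?n0// /D /d doubleMr.
Qed.

(** The 5 is [4 + 1], where 4 bounds [s^-m]. *)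
Lemma average_decay m i : (0 < m <= D)%N ->
  cabs (average R m).[node R c i / s%:C] <= 5 / (m%:R * tau i).
Proof.
move=> /andP[m0 mD]; have tp := node_dist_gt0 i; have sp := damping_gt0.
set y := node R c i / s%:C.
have yr : cabs y <= s^-1 by rewrite cabs_scaled_node.
have y1 : tau i <= cabs (y - 1).
  have -> : y - 1 = (node R c i - s%:C) * s%:C^-1.
    by rewrite mulrBl divff// fmorph_eq0 gt_eqF.
  by rewrite cabsM cabsV cabs_real gtr0_norm// ler_peMr ?damping_inv_ge1// ltW.
have mp : 0 < m%:R :> R by rewrite ltr0n.
rewrite ler_pdivlMr ?mulr_gt0// mulrC.
have := cabs_average_decay R m y _ m0 yr; set x := cabs (average R m).[y] => h.
have : m%:R * tau i * x <= m%:R * cabs (y - 1) * x.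
  by rewrite ler_wpM2r ?cabs_ge0// ler_wpM2l// ltW.
have : s^-1 ^+ m <= 4 by apply: le_trans damping_expn; rewrite ler_weXn2l// damping_inv_ge1.
lra.
Qed.

(** The product of the normalisation [1 / (P D)], of a geometric sum at most [2 / tau] and of the
    long average, at most [5 / (D tau)]. *)
Lemma weight_le_filter i :
  cabs (weight c s filter i) <=
  10 / (P%:R * D%:R ^+ 2 * tau i ^+ 2) * cabs (average R d).[node R c i / s%:C] ^+ n.
Proof.
have Dp : 0 < D%:R :> R by rewrite ltr0n (leq_trans _ filter_size_ge2).
have Pp : 0 < P%:R :> R by rewrite ltr0n.
have tp := node_dist_gt0 i; have sp := damping_gt0.
set z := node R c i; set y := z / s%:C.
have D0 : (0 < D <= D)%N by rewrite leqnn (leq_trans _ filter_size_ge2).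
have hD := average_decay D i D0.
have hw : cabs (\sum_(l < c.*2) (s%:C * conjc z) ^+ l) <= 2 / tau i.
  rewrite ler_pdivlMr//.
  have -> : tau i = cabs (s%:C * conjc z - 1).
    rewrite -[RHS](mul1r) -(cabs_node R c i) -cabsM mulrBr mulrCA node_conj !mulr1.
    by rewrite -cabsN opprB.
  rewrite mulrC -cabsM -subrX1; apply: le_trans (cabsD _ _ _) _.
  rewrite cabsN cabs1 (_ : 2 = 1 + 1)// lerD2r cabsX cabsM cabs_conj cabs_node mulr1.
  by rewrite cabs_real gtr0_norm// exprn_ile1 ?(ltW sp)// /s gerBl invr_ge0 ler0n.
rewrite /weight -/z -/y /filter /dampfilter -/d -/D hornerM horner_exp !cabsM cabsX mulrA.
rewrite ler_wpM2r ?exprn_ge0 ?cabs_ge0//.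
rewrite double_grid in hw *; rewrite cabsV cabs_nat natrM.
apply: (@le_trans _ _ ((P%:R * D%:R)^-1 * (2 / tau i) * (5 / (D%:R * tau i)))).
  have PD0 : 0 <= (P%:R * D%:R)^-1 :> R by rewrite invr_ge0 mulr_ge0.
  apply: ler_pM; [|exact: cabs_ge0|exact: ler_wpM2l|exact: hD].
  by rewrite mulr_ge0// cabs_ge0.
rewrite le_eqVlt; apply/orP; left; apply/eqP; field.
by rewrite !gt_eqF.
Qed.

Lemma node_dist_inv i : (i <= c.*2)%N ->
  (P%:R * D%:R ^+ 2 * tau i ^+ 2)^-1 <= P%:R / (P%:R ^+ 2 + b i ^+ 2).
Proof.
move=> ic; have Dp : 0 < D%:R :> R by rewrite ltr0n (leq_trans _ filter_size_ge2).
have Pp : 0 < P%:R :> R by rewrite ltr0n.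
have Sp : 0 < P%:R ^+ 2 + b i ^+ 2 by rewrite ltr_pwDl ?exprn_gt0 ?sqr_ge0.
have tp : 0 < tau i ^+ 2 by rewrite exprn_gt0 ?node_dist_gt0.
rewrite -[leRHS]invrK lef_pV2 ?posrE ?invr_gt0 ?divr_gt0 ?mulr_gt0 ?exprn_gt0 ?node_dist_gt0//.
have := node_dist_lower i ic; set S := _ + _ => h.
rewrite invf_div (_ : S / P%:R = P%:R * D%:R ^+ 2 * (S / (P%:R * D%:R) ^+ 2)).
  by rewrite ler_wpM2l// mulr_ge0// exprn_ge0// ltW.
by field; rewrite !gt_eqF.
Qed.

(** Here the short averages are only bounded, jointly by [s^-D <= 4]; whence [40 = 10 * 4]. *)
Lemma weight_le i : (i <= c.*2)%N ->
  cabs (weight c s filter i) <= 40 * (P%:R / (P%:R ^+ 2 + b i ^+ 2)).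
Proof.
move=> ic; apply: le_trans (weight_le_filter i) _.
have h : cabs (average R d).[node R c i / s%:C] ^+ n <= 4.
  have yr : cabs (node R c i / s%:C) <= s^-1 by rewrite cabs_scaled_node.
  have d0 : (0 < d)%N by rewrite double_gt0.
  apply: le_trans damping_expn; rewrite /D mulnC exprM.
  rewrite lerXn2r ?nnegrE ?cabs_ge0 ?cabs_average_le ?damping_inv_ge1//.
  by rewrite exprn_ge0// (le_trans ler01 damping_inv_ge1).
have h2 := node_dist_inv i ic.
have h0 : 0 <= (P%:R * D%:R ^+ 2 * tau i ^+ 2)^-1.
  by rewrite invr_ge0 !mulr_ge0 ?exprn_ge0 ?ler0n ?cabs_ge0.
apply: (@le_trans _ _ (10 / (P%:R * D%:R ^+ 2 * tau i ^+ 2) * 4)).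
  by rewrite ler_wpM2l// mulr_ge0.
lra.
Qed.

(** Beyond [|b| = 10 n P] one has [d tau >= 10], so each of the [n] short averages is at most
    [5 / 10]. *)
Lemma weight_tail i : (i <= c.*2)%N -> 10 * n%:R * P%:R <= `|b i| ->
  cabs (weight c s filter i) <= 10 * 2^-1 ^+ n * (P%:R / (P%:R ^+ 2 + b i ^+ 2)).
Proof.
move=> ic hb; apply: le_trans (weight_le_filter i) _.
have Dp : 0 < D%:R :> R by rewrite ltr0n (leq_trans _ filter_size_ge2).
have Pp : 0 < P%:R :> R by rewrite ltr0n.
have np : 0 < n%:R :> R by rewrite ltr0n.
have tp := node_dist_gt0 i.
have d0 : (0 < d <= D)%N by rewrite double_gt0 k0 /D leq_pmull.
have dp : 0 < d%:R :> R by rewrite ltr0n; case/andP: d0.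
have h1 : `|b i| <= P%:R * D%:R * tau i.
  rewrite -ler_sqr ?nnegrE ?mulr_ge0 ?(ltW tp)// real_normK ?num_real// exprMn.
  rewrite mulrC -ler_pdivrMr ?exprn_gt0 ?mulr_gt0//.
  apply: le_trans (node_dist_lower i ic).
  by rewrite ler_wpM2r ?lerDr ?sqr_ge0// invr_ge0 sqr_ge0.
have h2 : 10 <= d%:R * tau i.
  have := le_trans hb h1; rewrite /D natrM.
  rewrite (_ : 10 * n%:R * P%:R = n%:R * P%:R * 10); last by ring.
  rewrite (_ : P%:R * (n%:R * d%:R) * tau i = n%:R * P%:R * (d%:R * tau i)); last by ring.
  by rewrite ler_pM2l ?mulr_gt0.
have h : cabs (average R d).[node R c i / s%:C] ^+ n <= 2^-1 ^+ n.
  rewrite lerXn2r ?nnegrE ?cabs_ge0 ?invr_ge0//.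
  apply: le_trans (average_decay d i d0) _.
  by rewrite ler_pdivrMr ?mulr_gt0//; lra.
have h3 := node_dist_inv i ic.
have p0 : 0 <= 2^-1 ^+ n :> R by rewrite exprn_ge0// invr_ge0.
rewrite [leRHS]mulrAC.
apply: ler_pM => //; rewrite ?exprn_ge0 ?cabs_ge0//.
  by rewrite mulr_ge0// invr_ge0 !mulr_ge0 ?exprn_ge0 ?ler0n ?cabs_ge0.
by rewrite ler_wpM2l.
Qed.
End Bounds.

(** * Approximation by unitaries *)

Lemma sum_weight_le (R : realType) (n k P : nat) (A : pred 'I_(P * n * k).*2) (p : {poly R[i]}) (s K : R) :
  (0 < P)%N -> 0 <= K ->
  (forall i, A i -> cabs (weight (P * n * k) s p i) <=
     K * (P%:R / (P%:R ^+ 2 + (i%:R - (P * n * k)%:R) ^+ 2))) ->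
  \sum_(i | A i) cabs (weight (P * n * k) s p i) <= 8 * K.
Proof.
move=> P0 K0 h; have P1 : 1 <= P%:R :> R by rewrite ler1n.
apply: le_trans (ler_sum _ h) _; rewrite -mulr_sumr [leRHS]mulrC ler_wpM2l//.
apply: le_trans (lorentz_sum R P%:R (P * n * k) P1).
rewrite big_mkcond; apply: ler_sum => i _; case: ifP => // _.
by rewrite divr_ge0 ?ler0n// addr_ge0 ?sqr_ge0.
Qed.

(** The factor [D (1 - z)] of [L] in the sampled evolution. On the unit circle its real part is
    nonnegative, and it equals 1 at [z = s]. *)
Definition damprate {R : realType} (n k : nat) (z : R[i]) : R[i] :=
  (n * k.*2)%:R * (1 - z).

(** With [e = y^m], the factor [r (1 - y)] becomes [r] times the difference between levels [m] and
    [m.+1]: this is how the upwind scheme arises. *)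
Lemma scale_damped_split (F : fieldType) (V : lmodType F) (a e y u r : F) (p q : V) :
  (a * e) *: - (u *: p + (r * (1 - y)) *: q) =
  - (u *: ((a * e) *: p)) - r *: ((a * e) *: q - (a * (e * y)) *: q).
Proof.
by rewrite scalerN scalerDr opprD scalerBr !scalerA -scalerBl; congr (- (_ *: p) - _ *: q); ring.
Qed.

(** The error is level 0 of an upwind hierarchy whose initial data vanish up to level [(P - 2) D],
    by exactness of the weights. *)
Lemma sampling_error (R : realType) (N n k P : nat) (T : R) (H L : R -> 'M[R[i]]_N)
    (G : R[i] -> R -> 'M[R[i]]_N) (v : 'cV[R[i]]_N) :
  let D := (n * k.*2)%N in
  let c := (P * n * k)%N in
  let wt := weight c (1 - D%:R^-1) (dampfilter R n k) in
  (0 < n)%N -> (0 < k)%N -> (2 <= P)%N -> 0 < T -> mx_cont_on T L ->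
  (forall t : R, 0 <= t <= T -> is_hermitian (H t) /\ is_hermitian (L t) /\ psd (L t)) ->
  (forall w, toe_sol (damped H L w) T (G w)) ->
  vnorm (\sum_(i < c.*2) wt i *: (G (damprate n k (node R c i)) T *m v) - G 1 T *m v) ^+ 2 <=
  expR (D%:R * Rintegral lebesgue_measure `[0, T] (fun t => lambda_max (L t))) *
    (2^-1 ^+ ((P - 2) * D) * (321 * vnorm v) ^+ 2).
Proof.
move=> D c wt n0 k0 P2 T0 cL hHL hG.
have P0 : (0 < P)%N by exact: leq_trans P2.
have D0 : (0 < D)%N by rewrite muln_gt0 n0 double_gt0.
have Dp : 0 < D%:R :> R by rewrite ltr0n.
pose s : R := 1 - D%:R^-1.
have sp : 0 < s by exact: damping_gt0.
have s1 : s <= 1 by rewrite gerBl invr_ge0 ler0n.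
pose z i := node R c i.
pose w i := damprate n k (z i).
have w0 i : 0 <= complex.Re (w i).
  rewrite /w /damprate -(rmorph_nat (real_complex R)) cReM /= mul0r subr0.
  rewrite mulr_ge0 ?ler0n// cReD cReN subr_ge0 /z nodeE ?grid_gt0//; exact: cos_le1.
have hV u : vderiv T (fun t => G u t *m v) (fun t => - (damped H L u t *m (G u t *m v))).
  exact: toe_sol_vderiv.
have G0 u : G u 0 = 1%:M by have [] := hG u.
have bG u (t : R) : 0 <= complex.Re u -> 0 <= t <= T -> vnorm (G u t *m v) <= vnorm v.
  move=> u0 tT; have := damped_contraction _ _ _ _ _ _ _ u0 hHL (hV u) t tT.
  by rewrite G0 mul1mx.
pose psi m t := \sum_(i < c.*2) (wt i * z i ^+ m) *: (G (w i) t *m v) - s%:C ^+ m *: (G 1 t *m v).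
have -> : \sum_(i < c.*2) wt i *: (G (damprate n k (node R c i)) T *m v) - G 1 T *m v = psi 0%N T.
  by rewrite /psi expr0 scale1r; under [in RHS]eq_bigr do rewrite expr0 mulr1.
have sw : \sum_(i < c.*2) cabs (wt i) <= 320.
  rewrite (_ : 320 = 8 * 40); last by ring.
  apply: sum_weight_le => // i _; apply: weight_le => //; exact: ltnW.
rewrite sqr_vnorm; apply: (upwind_energy _ _ _ _ _ _ H L psi T0 (ltW Dp) (sqr_ge0 _) cL hHL).
- move=> m.
  pose U (t : R) (a b : 'cV[R[i]]_N) := - ('i *: (H t *m a)) - D%:R%:C *: (L t *m (a - b)).
  have key (a y u : R[i]) t (x : 'cV[R[i]]_N) : u = D%:R * (1 - y) ->
      (a * y ^+ m) *: - (damped H L u t *m x) = U t ((a * y ^+ m) *: x) ((a * y ^+ m.+1) *: x).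
    move=> ->; rewrite /U /damped mulmxDl mulmxBr -!scalemxAl -!scalemxAr exprSr.
    rewrite rmorph_nat; move: (H t *m x) (L t *m x) ('i : R[i]) (D%:R : R[i]) (y ^+ m) => p q ii dd ym.
    exact: scale_damped_split.
  apply: eq_vderiv _ _ (vderivB _ _ _ _ _ _ _
    (vderiv_sum _ _ _ _ (index_enum _) _ _
       (fun i : 'I_c.*2 => vderivZ _ _ _ (wt i * z i ^+ m) _ _ (hV (w i))))
    (vderivZ _ _ _ (s%:C ^+ m) _ _ (hV 1))) => t; first by [].
  have UB a a' b b' : U t (a - b) (a' - b') = U t a a' - U t b b'.
    rewrite /U !mulmxBr !scalerBr.
    move: ('i *: (H t *m a)) ('i *: (H t *m b)) => p q.
    move: (D%:R%:C *: (L t *m a)) (D%:R%:C *: (L t *m b)) => p1 q1.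
    move: (D%:R%:C *: (L t *m a')) (D%:R%:C *: (L t *m b')) => p2 q2.
    by apply/matrixP => i j; rewrite !mxE; ring.
  have Usum (a b : 'I_c.*2 -> 'cV[R[i]]_N) :
      U t (\sum_i a i) (\sum_i b i) = \sum_i U t (a i) (b i).
    rewrite /U -sumrB !mulmx_sumr !scaler_sumr -sumrN -sumrB.
    by apply: eq_bigr => i _.
  rewrite -/(U t (psi m t) (psi m.+1 t)) /psi UB Usum; congr (_ - _).
    by apply: eq_bigr => i _; apply: key.
  (* The target belongs to the same family: [D (1 - s) = 1]. *)
  have /= := key 1 s%:C 1 t (G 1 t *m v); rewrite !mul1r => -> //.
  by rewrite -(rmorph_nat (real_complex R)) -(rmorph1 (real_complex R)) -rmorphB -rmorphM
      /s subKr divff// gt_eqF.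
- move=> m t tT; have v3 : 0 <= 321 * vnorm v := mulr_ge0 (ler0n _ _) (vnorm_ge0 _ _ v).
  rewrite -sqr_vnorm ler_sqr ?nnegrE ?vnorm_ge0 ?v3//.
  rewrite /psi; apply: le_trans (vnormB _ _ _ _) _.
  (* 320 bounds the sum of the weights, and 1 accounts for [s^m <= 1]. *)
  rewrite (_ : 321 = 320 + 1); last by ring.
  rewrite mulrDl mul1r lerD//.
    apply: le_trans (vnorm_sum _ _ _ _ _ _) _.
    apply: (@le_trans _ _ (\sum_(i < c.*2) cabs (wt i) * vnorm v)).
      apply: ler_sum => i _; rewrite vnormZ cabsM cabsX cabs_node expr1n mulr1.
      by rewrite ler_wpM2l ?cabs_ge0// bG.
    by rewrite -mulr_suml ler_wpM2r ?vnorm_ge0.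
  rewrite vnormZ cabsX cabs_real gtr0_norm//.
  rewrite -[leRHS]mul1r ler_pM ?exprn_ge0 ?vnorm_ge0 ?(ltW sp)// ?exprn_ile1 ?(ltW sp)//.
  by rewrite bG.
- move=> m hm; rewrite /psi.
  under eq_bigr do rewrite G0 mul1mx.
  rewrite G0 mul1mx -scaler_suml -scalerBl.
  by rewrite weight_exact// subrr scale0r.
Qed.

Lemma card_window (q c B : nat) : (#|[pred i : 'I_q | (i < c + B)%N && (c < i + B)%N]| <= 2 * B)%N.
Proof.
case: B => [|B].
  by rewrite eq_card0// => i; rewrite !inE !addn0; lia.
have inj : {in [pred i : 'I_q | (i < c + B.+1)%N && (c < i + B.+1)%N] &,
    injective (fun i : 'I_q => inord (i + B.+1 - c) : 'I_(2 * B.+1).-1.+1)}.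
  move=> i j; rewrite !inE => hi hj /(congr1 val); rewrite /= !inordK; try lia.
  by move=> e; apply: val_inj => /=; lia.
have h := leq_card_in _ _ inj; rewrite card_ord in h.
by apply: (leq_trans h); rewrite mulnC.
Qed.

(** [n] and [P] fix the number of nodes, their range and the weight bound. [k], and with it [D], is
    chosen last and may depend on [T], [L] and [eps], because no bound in the conclusion involves
    it. *)
Lemma lchs_approximation (R : realType) (N n P : nat) (T eps : R) (H L : R -> 'M[R[i]]_N) :
  let eta := Rintegral lebesgue_measure `[0, T] (fun t => lambda_max (L t)) in
  (0 < n)%N -> (2 <= P)%N -> 0 < T -> 0 < eps ->
  mx_cont_on T H -> mx_cont_on T L ->
  (forall t : R, 0 <= t <= T -> is_hermitian (H t) /\ is_hermitian (L t) /\ psd (L t)) ->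
  240 * 2^-1 ^+ n <= eps -> expR eta <= 2^-1 * 2 ^+ (P - 2) ->
  exists (J : nat) (k : 'I_J -> R) (c : 'I_J -> R[i]),
    [/\ specnorm (texp (fun t => L t + 'i *: H t) T -
          \sum_(j < J) c j *: texp (fun s => 'i *: (H s + (k j)%:C *: L s)) T) <= eps,
        (J <= 20 * n * P)%N,
        forall j, `|k j| <= 20 * pi * n%:R &
        \sum_(j < J) cabs (c j) <= 320].
Proof.
move=> eta n0 P2 T0 e0 cH cL hHL hn hP.
have P0 : (0 < P)%N by exact: leq_trans P2.
have Pp : 0 < P%:R :> R by rewrite ltr0n.
have np : 0 < n%:R :> R by rewrite ltr0n.
have hG0 u : exists V, toe_sol (damped H L u) T V /\ texp (damped H L u) T = V T.
  have [|V hV VT] := texp_sol R N T (damped H L u) T0; last by exists V.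
  by apply: mx_cont_onD; exact: mx_cont_onZ.
have [G hG] : exists G, forall u, toe_sol (damped H L u) T (G u) /\
    texp (damped H L u) T = G u T.
  by exists (fun u => projT1 (cid (hG0 u))) => u; exact: (projT2 (cid (hG0 u))).
have G0 u : G u 0 = 1%:M by have [[]] := hG u.
have hV u v : vderiv T (fun t => G u t *m v) (fun t => - (damped H L u t *m (G u t *m v))).
  by apply: toe_sol_vderiv; have [] := hG u.
have [Lam hLam] := within_continuous_bounded R T _ (ltW T0)
  (continuous_lambda_max R N T L cL (fun t tT => (hHL t tT).2.1)).
have Lam0 : 0 <= Lam by apply: le_trans (normr_ge0 _) (hLam 0 _); rewrite lexx ltW.
have hLam' (t : R) : 0 <= t <= T -> lambda_max (L t) <= Lam.
  by move=> tT; exact: le_trans (ler_norm _) (hLam t tT).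
(* [theta] bounds the parameters of the kept unitaries. [Y1 / D] and [Y2 / D] will bound the squares
   of the sampling error and of the error of replacing evolutions by unitaries. *)
pose theta : R := 20 * pi * n%:R.
pose Y1 : R := 321 ^+ 2.
pose Y2 : R := 320 ^+ 2 * (5 / 2 * theta ^+ 2 * Lam * T).
have Y10 : 0 <= Y1 by exact: sqr_ge0.
have Y20 : 0 <= Y2.
  apply: mulr_ge0; first exact: sqr_ge0.
  apply: mulr_ge0; last exact: ltW.
  apply: mulr_ge0 => //; apply: mulr_ge0; last exact: sqr_ge0.
  by rewrite divr_ge0.
(* Any [D >= X] brings both squared errors below [(eps / 3)^2]. *)
pose X : R := 9 * (Y1 + Y2) / eps ^+ 2.
have X0 : 0 <= X.
  by rewrite /X divr_ge0 ?sqr_ge0// mulr_ge0// addr_ge0.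
pose k := (Num.trunc X).+1.
have k0 : (0 < k)%N by [].
pose D := (n * k.*2)%N.
have D0 : (0 < D)%N by rewrite muln_gt0 n0 double_gt0.
have Dp : 0 < D%:R :> R by rewrite ltr0n.
have XD : X <= D%:R.
  apply: (@le_trans _ _ k%:R); first by apply: ltW; exact: truncnS_gt.
  by rewrite ler_nat (leq_trans _ (leq_pmull _ n0))// -addnn leq_addr.
have e3 : 0 <= eps / 3 by rewrite divr_ge0// ltW.
have e320 : 0 < eps / 3 / 320 by apply: divr_gt0; [apply: divr_gt0; rewrite ?ltr0n|rewrite ltr0n].
have p320 : 0 < 320 ^+ 2 :> R by apply: exprn_gt0; rewrite ltr0n.
have XE : (Y1 + Y2) / D%:R <= (eps / 3) ^+ 2.
  have := XD; rewrite /X ler_pdivrMr ?exprn_gt0// => h; rewrite ler_pdivrMr//.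
  rewrite (_ : (eps / 3) ^+ 2 = eps ^+ 2 / 9); last by field.
  by move: h; lra.
have [XE1 XE2] : Y1 / D%:R <= (eps / 3) ^+ 2 /\ Y2 / D%:R <= (eps / 3) ^+ 2.
  by split; apply: le_trans XE; rewrite ler_wpM2r ?invr_ge0 ?(ltW Dp)// ?lerDl ?lerDr.
pose c := (P * n * k)%N.
have cp : 0 < c%:R :> R by rewrite ltr0n !muln_gt0 P0 n0.
pose s : R := 1 - D%:R^-1.
pose wt := weight c s (dampfilter R n k).
pose z i := node R c i.
pose w i := damprate n k (z i).
pose phi i : R := pi * ((i%:R - c%:R) / c%:R).
have zE i : z i = cis (phi i) by rewrite /z nodeE ?grid_gt0.
pose kap i : R := - (D%:R * sin (phi i)).
(* With this [kap] the two rates differ by a nonnegative real number, as [damped_close] requires. *)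
have wE i : w i - 'i * (kap i)%:C = (D%:R * (1 - cos (phi i)))%:C.
  rewrite /w /damprate zE -/D -(rmorph_nat (real_complex R)) /kap /cis.
  by apply/eqP; rewrite eq_complex /=; apply/andP; split; apply/eqP; ring.
have c1 i : 0 <= 1 - cos (phi i) by rewrite subr_ge0 cos_le1.
have w0 i : 0 <= complex.Re (w i).
  have := congr1 (@complex.Re R) (wE i); rewrite cReD cReN cReM /= => h.
  have := c1 i; have := ltW Dp => h1 h2; have := mulr_ge0 h1 h2.
  by move: h; lra.
have k0' i : 0 <= complex.Re ('i * (kap i)%:C) by rewrite cReM /=; lra.
(* The threshold of [weight_tail]: only nodes with centred index below it in modulus are kept. *)
pose B := (10 * n * P)%N.
pose S := [pred i : 'I_c.*2 | (i < c + B)%N && (c < i + B)%N].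
have SB (i : 'I_c.*2) : i \in S -> `|i%:R - c%:R| <= 10 * n%:R * P%:R :> R.
  rewrite inE => /andP[h1 h2].
  rewrite -!natrM -/B ler_distl lerBlDr -!natrD !ler_nat.
  by apply/andP; split; [exact: ltnW h2|exact: ltnW h1].
have SC (i : 'I_c.*2) : i \notin S -> 10 * n%:R * P%:R <= `|i%:R - c%:R| :> R.
  rewrite inE negb_and -!leqNgt -!natrM -/B => h.
  rewrite ler_normr; move: h => /orP[h|h]; apply/orP.
    by left; rewrite lerBrDl -natrD ler_nat.
  by right; rewrite opprB lerBrDl -natrD ler_nat.
have phiB (i : 'I_c.*2) : i \in S -> `|phi i| <= theta / D%:R.
  move=> /SB h; rewrite /phi normrM (ger0_norm (pi_ge0 R)) normrM normfV (gtr0_norm cp).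
  rewrite /theta; have -> : 20 * pi * n%:R / D%:R = pi * (10 * n%:R * P%:R / c%:R) :> R.
    rewrite /D /c -mul2n !natrM; move: (pi : R) => p; field.
    by rewrite !gt_eqF// ltr0n.
  by rewrite ler_wpM2l ?pi_ge0// ler_wpM2r// invr_ge0 ltW.
exists #|S|, (fun j => kap (enum_val j : 'I_c.*2)), (fun j => wt (enum_val j : 'I_c.*2)); split.
- apply: specnorm_le => v v1.
  have v0 := vnorm_ge0 _ _ v.
  have -> : texp (fun t => L t + 'i *: H t) T = G 1 T.
    rewrite -(hG 1).2; congr (texp _ T).
    by apply/funext => t; rewrite /damped scale1r addrC.
  have UE j : texp (fun s => 'i *: (H s + (kap j)%:C *: L s)) T = G ('i * (kap j)%:C) T.
    rewrite -(hG _).2; congr (texp _ T).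
    by apply/funext => t; rewrite /damped scalerDr scalerA.
  under eq_bigr do rewrite UE.
  rewrite -(@big_enum_val _ _ _ _ S (fun i : 'I_c.*2 => wt i *: G ('i * (kap i)%:C) T)).
  pose psi := \sum_(i < c.*2) wt i *: (G (w i) T *m v) - G 1 T *m v.
  pose tail := \sum_(i | i \notin S) wt i *: (G (w i) T *m v).
  pose diff := \sum_(i in S) wt i *: (G (w i) T *m v - G ('i * (kap i)%:C) T *m v).
  (* Three errors, each at most [eps / 3]: discarded nodes, replacement by unitaries, and
     sampling. *)
  have -> : (G 1 T - \sum_(i in S) wt i *: G ('i * (kap i)%:C) T) *m v = tail + diff - psi.
    have psiE : psi = \sum_(i in S) wt i *: (G (w i) T *m v) + tail - G 1 T *m v.
      by rewrite /psi (bigID (mem S)).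
    have UvE : (\sum_(i in S) wt i *: G ('i * (kap i)%:C) T) *m v =
        \sum_(i in S) wt i *: (G ('i * (kap i)%:C) T *m v).
      by rewrite mulmx_suml; apply: eq_bigr => i _; rewrite -scalemxAl.
    have dE : diff = \sum_(i in S) wt i *: (G (w i) T *m v) -
        \sum_(i in S) wt i *: (G ('i * (kap i)%:C) T *m v).
      by rewrite /diff -sumrB; apply: eq_bigr => i _; rewrite scalerBr.
    rewrite mulmxBl UvE psiE dE; clear psiE UvE dE.
    move: (\sum_(i in S) _) (\sum_(i in S) _) tail (G 1 T *m v) => x y t g.
    by apply/matrixP => i j; rewrite !mxE; ring.
  have h1 : vnorm psi <= eps / 3.
    rewrite -ler_sqr ?nnegrE ?vnorm_ge0//.
    have hs := sampling_error R N n k P T H L G v n0 k0 P2 T0 cL hHL (fun u => (hG u).1).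
    apply: le_trans hs _; rewrite -/eta -/D.
    apply: le_trans XE1.
    rewrite mulrA expRM_natl exprM -exprMn.
    (* The choice of [P] makes the amplification per unit of [D] at most 1/2; its power [D] is then
       at most [2^-D <= 1/D]. *)
    have q1 : expR eta * 2^-1 ^+ (P - 2) <= 2^-1.
      by rewrite exprVn ler_pdivrMr ?exprn_gt0.
    have q2 : (expR eta * 2^-1 ^+ (P - 2)) ^+ D <= D%:R^-1.
      apply: (@le_trans _ _ (2^-1 ^+ D)).
        by rewrite lerXn2r ?nnegrE ?invr_ge0// mulr_ge0 ?expR_ge0 ?exprn_ge0 ?invr_ge0.
      by rewrite exprVn lef_pV2 ?posrE ?exprn_gt0// -natrX ler_nat ltnW// ltn_expl.
    rewrite mulrC ler_pM ?sqr_ge0 ?exprn_ge0 ?mulr_ge0 ?expR_ge0 ?exprn_ge0 ?invr_ge0//.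
    by rewrite /Y1 exprMn ler_piMr ?sqr_ge0// exprn_ile1.
  have bG u : 0 <= complex.Re u -> vnorm (G u T *m v) <= 1.
    move=> u0; have := damped_contraction _ _ _ _ _ _ _ u0 hHL (hV u v) T.
    by rewrite lexx ltW// G0 mul1mx => /(_ isT) /le_trans; apply.
  have h2 : vnorm tail <= eps / 3.
    apply: le_trans (vnorm_sum _ _ _ _ _ _) _.
    apply: (@le_trans _ _ (\sum_(i < c.*2 | i \notin S) cabs (wt i))).
      apply: ler_sum => i _; rewrite vnormZ ler_piMr ?cabs_ge0//; exact: bG.
    (* 80 times [2^-n] is a third of the 240 in the hypothesis on [n]. *)
    apply: (@le_trans _ _ (8 * (10 * 2^-1 ^+ n))); last by move: hn; lra.
    apply: sum_weight_le; [by []|by rewrite mulr_ge0// exprn_ge0// invr_ge0|].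
    move=> i iS; apply: weight_tail => //; [exact: ltnW|exact: SC].
  have h3 : vnorm diff <= eps / 3.
    (* The weights sum to at most 320, so each kept node may contribute an error of
       [eps / 3 / 320]. *)
    have each (i : 'I_c.*2) : i \in S ->
        vnorm (G (w i) T *m v - G ('i * (kap i)%:C) T *m v) <= eps / 3 / 320.
      move=> iS; rewrite (vnorm_le _ _ _ _ (ltW e320)).
      have a0 : 0 <= D%:R * (1 - cos (phi i)) by rewrite mulr_ge0// ltW.
      have eq0 : G (w i) 0 *m v = G ('i * (kap i)%:C) 0 *m v by rewrite !G0.
      have := damped_close _ _ _ _ _ _ _ _ Lam _ _ (ltW T0) (w0 i) (k0' i) a0 (wE i) hHL hLam'
        (hV _ v) (hV _ v) eq0.
      rewrite G0 mul1mx => /le_trans; apply.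
      rewrite -(ler_pM2l p320).
      rewrite [leRHS](_ : _ = (eps / 3) ^+ 2); last by field.
      apply: le_trans XE2; rewrite /Y2 -[leRHS]mulrA ler_wpM2l ?sqr_ge0//.
      have a1 : D%:R * (1 - cos (phi i)) <= theta ^+ 2 / 2 / D%:R.
        apply: (@le_trans _ _ (D%:R * (phi i ^+ 2 / 2))).
          by rewrite ler_wpM2l ?(ltW Dp)// onem_cos_le.
        rewrite (_ : theta ^+ 2 / 2 / D%:R = D%:R * ((theta / D%:R) ^+ 2 / 2)); last first.
          by field; rewrite gt_eqF.
        rewrite ler_wpM2l ?(ltW Dp)// ler_wpM2r ?invr_ge0//.
        rewrite -[leLHS]real_normK ?num_real// ler_sqr ?nnegrE//; first exact: phiB.
        by rewrite divr_ge0 ?(ltW Dp)// /theta !mulr_ge0 ?pi_ge0.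
      apply: (@le_trans _ _ (5 * (theta ^+ 2 / 2 / D%:R) * Lam * T)).
        rewrite -[leRHS]mulr1 ler_pM//.
        - by rewrite !mulr_ge0// ltW.
        - by rewrite sqr_ge0.
        - by rewrite ler_wpM2r ?(ltW T0)// ler_wpM2r// ler_wpM2l.
        - by rewrite exprn_ile1.
      by rewrite le_eqVlt; apply/orP; left; apply/eqP; field; rewrite gt_eqF.
    apply: le_trans (vnorm_sum _ _ _ _ _ _) _.
    apply: (@le_trans _ _ (\sum_(i < c.*2 | i \in S) cabs (wt i) * (eps / 3 / 320))).
      by apply: ler_sum => i iS; rewrite vnormZ ler_wpM2l ?cabs_ge0// each.
    rewrite -mulr_suml mulrC -(ler_pdivlMl _ _ e320).
    rewrite (_ : _ * _ = 8 * 40); last by field; rewrite gt_eqF.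
    by apply: sum_weight_le => // i _; apply: weight_le => //; exact: ltnW.
  apply: le_trans (vnormB _ _ _ _) _.
  apply: le_trans (lerD (le_trans (vnormD _ _ _ _) (lerD h2 h3)) h1) _.
  by rewrite (_ : _ + _ + _ = eps)//; field.
- by have h := card_window c.*2 c B; apply: (leq_trans h); rewrite /B !mulnA.
- move=> j; have := phiB _ (enum_valP j); set f := phi _ => hf.
  rewrite /kap normrN normrM (gtr0_norm Dp).
  apply: le_trans (ler_wpM2l (ltW Dp) (abs_sin_le R f)) _.
  by rewrite mulrC -ler_pdivlMr.
- rewrite -(@big_enum_val _ _ _ _ S (fun i : 'I_c.*2 => cabs (wt i))).
  rewrite (_ : 320 = 8 * 40); last by ring.
  by apply: sum_weight_le => // i _; apply: weight_le => //; exact: ltnW.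
Qed.

(** * Choice of parameters and asymptotic bounds *)

Theorem theorem2 (R : realType) :
  exists (K : R) (eps0 : R), 0 < K /\ 0 < eps0 < 1 /\
  forall (N : nat) (T : R) (H L : R -> 'M[R[i]]_N),
    0 < T ->
    mx_cont_on T H -> mx_cont_on T L ->
    (forall t, 0 <= t <= T -> is_hermitian (H t) /\ is_hermitian (L t) /\ psd (L t)) ->
    let A := fun t => L t + 'i *: H t in
    let eta_max := Rintegral lebesgue_measure `[0, T] (fun t => lambda_max (L t)) in
    forall eps1 : R, 0 < eps1 < 1 ->
    exists (J : nat) (k : 'I_J -> R) (c : 'I_J -> R[i]),
      specnorm (texp A T -
                \sum_(j < J) c j *: texp (fun s => 'i *: (H s + (k j)%:C *: L s)) T)
        <= eps1 /\
      (eps1 < eps0 ->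
        J%:R <= K * ln (eps1^-1) * (ln (eps1^-1) + eta_max) /\
        (forall j, `|k j| <= K * ln (eps1^-1)) /\
        \sum_(j < J) cabs (c j) <= K).
Proof.
have l2 : 0 < ln 2 :> R by rewrite ln_gt0// ltr1n.
have pow2 m : expR (m%:R * ln 2) = 2 ^+ m :> R.
  by rewrite expRM_natl lnK// posrE.
pose a : R := (ln 2)^-1; have a0 : 0 < a by rewrite invr_gt0.
pose g : R := ln 240; have g0 : 0 <= g by apply: ln_ge0; rewrite ler1n.
(* Chosen so that [n <= K1 l] and [P <= K2 (l + eta)] once [l >= 1]. *)
pose K1 : R := (g + 1) * a + 1; pose K2 : R := a + 4.
have K10 : 0 < K1 by rewrite /K1 ltr_wpDl// mulr_ge0 ?addr_ge0// ltW.
have K20 : 0 < K2 by rewrite /K2 addr_gt0.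
have pi0 : 0 <= 20 * pi :> R by rewrite mulr_ge0// pi_ge0.
pose K0 : R := 20 * (K1 * K2); have K00 : 0 <= K0 by rewrite /K0 !mulr_ge0 ?ltW.
pose K0' : R := 20 * pi * K1; have K00' : 0 <= K0' by rewrite /K0' mulr_ge0 ?(ltW K10).
(* The three summands serve the number of terms, the parameters and the coefficients. The threshold
   [exp (-1)] gives [l >= 1], which absorbs additive constants. *)
exists (K0 + K0' + 320), (expR (- 1)); split; first by rewrite ltr_wpDl ?addr_ge0 ?ltr0n.
split; first by rewrite expR_gt0/= expR_lt1 ltrN10.
move=> N T H L T0 cH cL hHL A eta eps /andP[e0 e1].
have eta0 : 0 <= eta.
  apply: Rintegral_ge0 => t /=; rewrite in_itv/= => /hHL [_ [hL pL]].
  exact: lambda_max_ge0.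
set l := ln eps^-1.
have l0 : 0 < l by rewrite /l ln_gt0// invf_gt1.
have epsE : eps = expR (- l) by rewrite expRN lnK ?invrK// posrE invr_gt0.
(* [n] exceeds the base-2 logarithm of [240 / eps]. [P] will be [m.+2]; in [m], one unit rounds
   [eta / ln 2] up and the other pays for the factor 1/2 required of [P]. *)
pose n := (Num.trunc ((g + l) * a)).+1; pose m := (Num.trunc (eta * a)).+2.
have gl0 : 0 <= (g + l) * a by rewrite mulr_ge0 ?addr_ge0// ltW.
have ea0 : 0 <= eta * a by rewrite mulr_ge0// ltW.
have hn : 240 * 2^-1 ^+ n <= eps.
  rewrite exprVn -pow2 -expRN epsE (_ : 240 = expR g); last by rewrite lnK// posrE ltr0n.
  have h : g + l < n%:R * ln 2 by rewrite -ltr_pdivrMr//; exact: truncnS_gt.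
  by rewrite -expRD ler_expR lerBlDr addrC -lerBlDr opprK ltW.
have hm : expR eta <= 2^-1 * 2 ^+ (m.+2 - 2).
  rewrite subSS subSS subn0 -pow2 -ler_pdivrMl ?invr_gt0// invrK.
  have h : eta < (Num.trunc (eta * a)).+1%:R * ln 2.
    by rewrite -ltr_pdivrMr//; exact: truncnS_gt.
  have -> : 2 * expR eta = expR (ln 2 + eta) by rewrite expRD lnK// posrE.
  have -> : m%:R = (Num.trunc (eta * a)).+1%:R + 1 :> R by rewrite natr1.
  by rewrite ler_expR mulrDl mul1r [ln 2 + eta]addrC lerD2r ltW.
have [J [k [c [h1 h2 h3 h4]]]] := lchs_approximation R N n m.+2 T eps H L isT isT T0 e0 cH cL hHL hn hm.
exists J, k, c; split; first exact: h1.
move=> eps_lt; have l1 : 1 <= l.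
  by move: eps_lt; rewrite epsE ltr_expR ltrN2 => /ltW.
have nK : n%:R <= K1 * l.
  rewrite /n -natr1 (_ : K1 * l = (g + 1) * a * l + l); last by rewrite /K1; ring.
  apply: lerD => //.
  have : (Num.trunc ((g + l) * a))%:R <= (g + l) * a by rewrite truncn_le.
  move=> /le_trans; apply; rewrite mulrAC ler_wpM2r ?(ltW a0)//.
  by rewrite mulrDl mul1r lerD2r ler_peMr.
have mK : m.+2%:R <= K2 * (l + eta).
  rewrite /m /K2 mulrDl; have -> : (Num.trunc (eta * a)).+4%:R = (Num.trunc (eta * a))%:R + 4 :> R.
    by rewrite -natrD addn4.
  apply: lerD; last by rewrite ler_peMr// (le_trans l1)// lerDl.
  have : (Num.trunc (eta * a))%:R <= eta * a by rewrite truncn_le.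
  by move=> /le_trans; apply; rewrite mulrC ler_wpM2l ?(ltW a0)// lerDr ltW.
have KK : K0' + 320 >= 0 by rewrite addr_ge0 ?ler0n.
split; last split.
- apply: (@le_trans _ _ (K0 * l * (l + eta))).
    apply: (@le_trans _ _ (20 * n * m.+2)%:R); first by rewrite ler_nat.
    rewrite !natrM -mulrA (_ : K0 * l * (l + eta) = 20 * (K1 * l * (K2 * (l + eta)))); last by rewrite /K0; ring.
    by rewrite ler_wpM2l ?ler0n// ler_pM ?ler0n.
  by rewrite ler_wpM2r ?addr_ge0 ?(ltW l0)// ler_wpM2r ?(ltW l0)// -addrA lerDl.
- move=> j; apply: le_trans (h3 j) _.
  apply: (@le_trans _ _ (K0' * l)); first by rewrite /K0' -[leRHS]mulrA ler_wpM2l.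
  by rewrite ler_wpM2r ?(ltW l0)// addrAC lerDr addr_ge0 ?ler0n.
- by apply: le_trans h4 _; rewrite lerDr addr_ge0.
Qed.
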